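(* Consider the relaxed assortment and fulfillment problem described in the context, with an arbitrary choice model $\phi$ satisfying the stated assumptions, and a fixed nonzero inventory placement $\boldsymbol c=(c_i^\ell)\in\mathbb Z_+^{nL}$. Let $c_{\min}=\min\{c_i^\ell : i\in\mathcal N,\ \ell\in\mathcal L,\ c_i^\ell>0\}$. Suppose arrivals are stationary, i.e. $\lambda_{jt}=\lambda_j$ for all $t\in\mathcal T$ and $j\in\mathcal M$. Then one can compute in polynomial time a (randomized) assortment and fulfillment policy whose expected total profit starting from inventory $\boldsymbol c$ is at least $$\max\left\{1-\frac1e,\ 1-\frac{1}{\sqrt{c_{\min}}}\right\}\cdot J_1^*(\boldsymbol c).$$
   Context: Setting. Products $\mathcal N=\{1,\dots,n\}$, customer types $\mathcal M=\{1,\dots,m\}$, warehouses $\mathcal L=\{1,\dots,L\}$, time periods $\mathcal T=\{1,\dots,T\}$. In each period $t$ at most one customer arrives; a type-$j$ customer arrives with probability $\lambda_{jt}\ge 0$ (with $\sum_{j}\lambda_{jt}\le 1$), independently across periods. If a type-$j$ customer is offered the assortment $S\subseteq\mathcal N$, she chooses product $i$ with probability $\phi_{ij}(S)$ and nothing with probability $1-\sum_{i}\phi_{ij}(S)\geq 0$; choices are independent across periods. Assumptions on $\phi$: $\phi_{kj}(S)=0$ if $k\notin S$; weak substitutability: $\phi_{ij}(S\cup\{k\})\le\phi_{ij}(S)$ for all $S$, $i\in S$, $k\notin S$. Serving product $i$ to a type-$j$ customer from warehouse $\ell$ gives profit $r_{ij}^\ell\in\mathbb R$ (possibly negative). Relaxed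 problem. A virtual warehouse $L+1$ with infinite stock of each product and profits $r_{ij}^{L+1}=0$ is added; $\mathcal L_+=\mathcal L\cup\{L+1\}$. Start with inventory $c_i^\ell$ of product $i$ at warehouse $\ell\in\mathcal L$. On the arrival of a type-$j$ customer in period $t$, the policy (knowing the type, the period and the history/current inventory $\boldsymbol x$, and possibly randomizing) offers an assortment $S\subseteq\mathcal N$ and decides, for each $i\in S$, a warehouse $f(i)\in\mathcal L_+$ from which $i$ is served if chosen, where $f(i)\in\mathcal L$ is allowed only if $x_i^{f(i)}>0$. If product $i$ is chosen, the profit $r_{ij}^{f(i)}$ is earned and, when $f(i)\in\mathcal L$, the stock $x_i^{f(i)}$ decreases by one. $J_1^*(\boldsymbol c)$ denotes the maximum expected total profit over the $T$ periods among all such policies. Computational model. There is a polynomial-time oracle which, given a customer type $j$ and per-product rewards $(\rho_i)_{i\in\mathcal N}$, returns $S\subseteq\mathcal N$ maximizing $\sum_{i\in S}\rho_i\phi_{ij}(S)$. Polynomial time is with respect to the input size (including $n,m,L,T$). *)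

(* Defs.v *)
From HB Require Import structures.
From mathcomp Require Import all_boot all_order all_algebra.
From mathcomp Require Import boolp classical_sets reals.

Set Implicit Arguments.
Unset Strict Implicit.
Unset Printing Implicit Defensive.

Import Order.TTheory GRing.Theory Num.Theory.
Local Open Scope ring_scope.

(** * The relaxed assortment and fulfillment problem *)

(** Products, customer types, warehouses and periods are 'I_n, 'I_m, 'I_L and
    'I_T.  An element of [option 'I_L] is a warehouse of L_+, [None] being the
    virtual warehouse L+1. *)
Record problem (R : realType) (n m L T : nat) := Problem {
  lam : 'I_m -> 'I_T -> R;
  phi : 'I_n -> 'I_m -> {set 'I_n} -> R;
  profit : 'I_n -> 'I_m -> 'I_L -> R;
  stock0 : 'I_n -> 'I_L -> nat }.

Section Problem.
Variables (R : realType) (n m L T : nat).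
Implicit Types P : problem R n m L T.

Definition arrival_probabilities P : Prop :=
  (forall j t, 0 <= lam P j t) /\ (forall t, \sum_j lam P j t <= 1).

Definition choice_model P : Prop :=
  [/\ forall i j S, 0 <= phi P i j S,
      forall j S, \sum_i phi P i j S <= 1,
      forall k j (S : {set 'I_n}), k \notin S -> phi P k j S = 0
    & forall i k j (S : {set 'I_n}), i \in S -> k \notin S ->
        phi P i j (k |: S) <= phi P i j S].

Definition stationary P : Prop := forall j t t', lam P j t = lam P j t'.

(** The assortment S and the fulfillment map f; the values of f outside S are
    irrelevant. *)
Definition decision : Type := ({set 'I_n} * {ffun 'I_n -> option 'I_L})%type.

(** What happens in one period: [None] if nobody arrives, and [Some (j, d, o)]
    if a type-j customer arrives, is offered d, and chooses o. *)
Definition event : Type := option ('I_m * decision * option 'I_n)%type.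

(** A history lists the events of the periods before the current one, so its
    size is the (0-based) current period. *)
Definition history : Type := seq event.

Definition sells (i : 'I_n) (l : 'I_L) (e : event) : bool :=
  if e is Some (_, d, Some i') then (i' == i) && (d.2 i' == Some l) else false.

Definition stock P (h : history) (i : 'I_n) (l : 'I_L) : nat :=
  (stock0 P i l - count (sells i l) h)%N.

(** [pi h j d] is the probability that decision d is made for an arriving
    type-j customer after the history h. *)
Definition policy : Type := history -> 'I_m -> decision -> R.

Definition feasible P (pi : policy) : Prop := forall h j,
  [/\ forall d, 0 <= pi h j d,
      \sum_(d : decision) pi h j d = 1
    & forall d, 0 < pi h j d ->
        forall i l, i \in d.1 -> d.2 i = Some l -> (0 < stock P h i l)%N].

Definition event_prob P (pi : policy) (h : history) (t : 'I_T) (e : event) : R :=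
  match e with
  | None => 1 - \sum_j lam P j t
  | Some (j, d, Some i) => lam P j t * pi h j d * phi P i j d.1
  | Some (j, d, None) => lam P j t * pi h j d * (1 - \sum_i phi P i j d.1)
  end.

Definition event_profit P (e : event) : R :=
  if e is Some (j, d, Some i) then
    if d.2 i is Some l then profit P i j l else 0
  else 0.

Definition expected_profit P (pi : policy) : R :=
  \sum_(w : T.-tuple event)
    (\prod_(t < T) event_prob P pi (take t w) t (tnth w t)) *
    (\sum_(t < T) event_profit P (tnth w t)).

Definition J1_star P : R :=
  sup [set v | exists2 pi, feasible P pi & v = expected_profit P pi]%classic.

(** The default value of the iterated [minn] is the largest entry, which does
    not affect the minimum when c is nonzero. *)
Definition cmin P : nat :=
  \big[minn/(\max_(p : 'I_n * 'I_L) stock0 P p.1 p.2)%N]_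
    (p : 'I_n * 'I_L | (0 < stock0 P p.1 p.2)%N) stock0 P p.1 p.2.

Definition oracle : Type := 'I_m -> {ffun 'I_n -> R} -> {set 'I_n}.

Definition assortment_oracle P (O : oracle) : Prop := forall j (rho : {ffun 'I_n -> R}) (S : {set 'I_n}),
  \sum_(i in S) rho i * phi P i j S <= \sum_(i in O j rho) rho i * phi P i j (O j rho).

End Problem.

(** * Computational model

    Uniform oracle random access machines, presented as a while language over
    arrays of natural numbers and arrays of reals.  Cell [(a, idx)] is the
    entry with index tuple [idx] of the array named [a]; scalars are the
    entries with the empty index tuple. *)

Definition cell : Type := (nat * seq nat)%type.

(** An operand [(a, vs)] of an instruction denotes entry [x1, .., xk] of the
    array [a], where [x1, .., xk] are the contents of the scalar natural-number
    variables [vs]. *)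
Definition operand : Type := (nat * seq nat)%type.

Inductive natop := NAdd | NSub.
Inductive realop := RAdd | RSub | RMul | RDiv.

Inductive cmd :=
| Skip
| NConst (x : operand) (k : nat)
| NOp (o : natop) (x y z : operand)
| RConst (x : operand) (k : int)
| ROfNat (x y : operand)
| ROp (o : realop) (x y z : operand)
  (** [Phi x i j a] stores phi_ij(S) in the real cell x, where S is the set of
      products whose entry in the natural-number array [a] is nonzero. *)
| Phi (x i j : operand) (a : nat)
  (** [Oracle j rho a] calls the assortment oracle with the type j and the
      rewards in the real array [rho], and stores the indicator function of its
      answer in the natural-number array [a]. *)
| Oracle (j : operand) (rho a : nat)
| Seq (c1 c2 : cmd)
| IfNat (y z : operand) (c1 c2 : cmd)
| IfReal (y z : operand) (c1 c2 : cmd)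
| While (y z : operand) (c : cmd).

Record memory (R : realType) := Memory {
  nmem : cell -> nat;
  rmem : cell -> R }.

Definition at_index (V : Type) (v0 : V) (n : nat) (F : 'I_n -> V) (i : nat) : V :=
  if insub i is Some i' then F i' else v0.

Section Semantics.
Variables (R : realType) (n m L T : nat).
Variables (P : problem R n m L T) (O : oracle R n m).
Implicit Types (s : memory R) (x y z : operand).

Definition loc s x : cell := (x.1, [seq nmem s (v, [::]) | v <- x.2]).
Definition nval s x : nat := nmem s (loc s x).
Definition rval s x : R := rmem s (loc s x).

Definition nwrite s x (v : nat) : memory R :=
  Memory [eta nmem s with loc s x |-> v] (rmem s).
Definition rwrite s x (v : R) : memory R :=
  Memory (nmem s) [eta rmem s with loc s x |-> v].

Definition nat_op (o : natop) : nat -> nat -> nat :=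
  match o with NAdd => addn | NSub => subn end.

Definition real_op (o : realop) (u v : R) : R :=
  match o with RAdd => u + v | RSub => u - v | RMul => u * v | RDiv => u / v end.

Definition phi_query s (i j : operand) (a : nat) : R :=
  let S := [set i' : 'I_n | nmem s (a, [:: i' : nat]) != 0%N] in
  at_index 0 (fun i' => at_index 0 (fun j' => phi P i' j' S) (nval s j)) (nval s i).

Definition oracle_query s (j : operand) (rho a : nat) : memory R :=
  at_index s (fun j' : 'I_m =>
    let S := O j' [ffun i : 'I_n => rmem s (rho, [:: i : nat])] in
    Memory (fun u => if u is (b, [:: i]) then
                       if b == a then
                         at_index (nmem s u) (fun i' : 'I_n => (i' \in S) : nat) i
                       else nmem s u
                     else nmem s u)
           (rmem s)) (nval s j).

(** [exec ok c s t s']: started in memory s, the program c halts in memory s'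
    after t steps (instructions, tests and oracle calls), and every real number
    it writes satisfies [ok]. *)
Inductive exec (ok : R -> Prop) : cmd -> memory R -> nat -> memory R -> Prop :=
| ExecSkip s : exec ok Skip s 1 s
| ExecNConst s x k : exec ok (NConst x k) s 1 (nwrite s x k)
| ExecNOp s o x y z :
    exec ok (NOp o x y z) s 1 (nwrite s x (nat_op o (nval s y) (nval s z)))
| ExecRConst s x k : ok k%:~R -> exec ok (RConst x k) s 1 (rwrite s x k%:~R)
| ExecROfNat s x y :
    ok (nval s y)%:R -> exec ok (ROfNat x y) s 1 (rwrite s x (nval s y)%:R)
| ExecROp s o x y z :
    ok (real_op o (rval s y) (rval s z)) ->
    exec ok (ROp o x y z) s 1 (rwrite s x (real_op o (rval s y) (rval s z)))
| ExecPhi s x i j a :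
    ok (phi_query s i j a) ->
    exec ok (Phi x i j a) s 1 (rwrite s x (phi_query s i j a))
| ExecOracle s j rho a : exec ok (Oracle j rho a) s 1 (oracle_query s j rho a)
| ExecSeq c1 c2 s1 s2 s3 t1 t2 :
    exec ok c1 s1 t1 s2 -> exec ok c2 s2 t2 s3 ->
    exec ok (Seq c1 c2) s1 (t1 + t2) s3
| ExecIfNat y z c1 c2 s s' t :
    exec ok (if (nval s y < nval s z)%N then c1 else c2) s t s' ->
    exec ok (IfNat y z c1 c2) s t.+1 s'
| ExecIfReal y z c1 c2 s s' t :
    exec ok (if rval s y <= rval s z then c1 else c2) s t s' ->
    exec ok (IfReal y z c1 c2) s t.+1 s'
| ExecWhileStop y z c s :
    (nval s z <= nval s y)%N -> exec ok (While y z c) s 1 s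
| ExecWhileStep y z c s1 s2 s3 t1 t2 :
    (nval s1 y < nval s1 z)%N ->
    exec ok c s1 t1 s2 -> exec ok (While y z c) s2 t2 s3 ->
    exec ok (While y z c) s1 (t1 + t2).+1 s3.

(** Encoding of a decision: 0 for a product that is not offered, and otherwise
    the 1-based number of the warehouse serving it (L+1 for the virtual one). *)
Definition decision_code (d : decision n L) (i : 'I_n) : nat :=
  if i \in d.1 then (if d.2 i is Some l then l.+1 else L.+1) else 0%N.

Definition event_type_code (e : event n m L) : nat :=
  if e is Some (j, _, _) then j.+1 else 0%N.
Definition event_choice_code (e : event n m L) : nat :=
  if e is Some (_, _, Some i) then i.+1 else 0%N.
Definition event_decision_code (e : event n m L) (i : 'I_n) : nat :=
  if e is Some (_, d, _) then decision_code d i else 0%N.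

Definition scalar (V : Type) (v0 v : V) (idx : seq nat) : V :=
  if idx is [::] then v else v0.
Definition array1 (V : Type) (v0 : V) n1 (F : 'I_n1 -> V) (idx : seq nat) : V :=
  if idx is [:: i1] then at_index v0 F i1 else v0.
Definition array2 (V : Type) (v0 : V) n1 n2 (F : 'I_n1 -> 'I_n2 -> V)
    (idx : seq nat) : V :=
  if idx is [:: i1; i2] then at_index v0 (fun i => at_index v0 (F i) i2) i1 else v0.
Definition array3 (V : Type) (v0 : V) n1 n2 n3 (F : 'I_n1 -> 'I_n2 -> 'I_n3 -> V)
    (idx : seq nat) : V :=
  if idx is [:: i1; i2; i3] then
    at_index v0 (fun i => at_index v0 (fun j => at_index v0 (F i j) i3) i2) i1
  else v0.

(** Natural-number inputs: the position in the list is the name of the array. *)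
Definition nat_inputs (h : history n m L) (j : 'I_m) : seq (seq nat -> nat) :=
  [:: scalar 0%N n; scalar 0%N m; scalar 0%N L; scalar 0%N T;
      scalar 0%N (size h); scalar 0%N (j : nat);
      array2 0%N (stock0 P); array2 0%N (stock P h);
      array1 0%N (fun t : 'I_(size h) => event_type_code (nth None h t));
      array1 0%N (fun t : 'I_(size h) => event_choice_code (nth None h t));
      array2 0%N (fun t : 'I_(size h) => event_decision_code (nth None h t)) ].

Definition real_inputs : seq (seq nat -> R) :=
  [:: array2 0 (lam P); array3 0 (profit P) ].

Definition initial_memory (h : history n m L) (j : 'I_m) : memory R :=
  Memory (fun u => nth (fun=> 0%N) (nat_inputs h j) u.1 u.2)
         (fun u => nth (fun=> 0) real_inputs u.1 u.2).

(** The final memory s lists a probability distribution D on decisions as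
    finitely many weighted decisions: their number K is the scalar 0, the
    weight of the k-th one is entry k of the real array 0, and its code is row
    k of the natural-number array 1. *)
Definition outputs s (D : decision n L -> R) : Prop :=
  let K := nmem s (0%N, [::]) in
  let weight (k : nat) := rmem s (0%N, [:: k]) in
  exists ds : 'I_K -> decision n L,
    [/\ forall k : 'I_K, 0 <= weight k,
        forall (k : 'I_K) (i : 'I_n),
          nmem s (1%N, [:: k : nat; i : nat]) = decision_code (ds k) i
      & forall d, D d = \sum_(k < K | ds k == d) weight k].

Definition has_bits (B : nat) (u : R) : Prop :=
  exists2 q : rat, u = ratr q & (`|numq q| < 2 ^ B)%N && (`|denq q| < 2 ^ B)%N.

Definition data_bits (B : nat) : Prop :=
  [/\ forall j t, has_bits B (lam P j t),
      forall i j S, has_bits B (phi P i j S),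
      forall i j l, has_bits B (profit P i j l)
    & forall i l, (stock0 P i l < 2 ^ B)%N].

(** The number of steps is polynomial in n, m, L and T, for arbitrary real data
    (unit-cost arithmetic).  Moreover, if all data are rational numbers with at
    most B bits, then so are all numbers that are computed, with a number of
    bits polynomial in n, m, L, T and B; the running time is then polynomial in
    the usual sense of bit complexity.  There is no unit-cost multiplication of
    natural numbers, so the bit lengths of the contents of [nmem] grow by at
    most one per step. *)
Definition computes_within (prog : cmd) (a k : nat) (pi : policy R n m L) : Prop :=
  forall (h : history n m L) (j : 'I_m), (size h < T)%N ->
  exists s t,
    [/\ exec (fun u => forall B, data_bits B ->
                has_bits (a * (n + m + L + T + B).+1 ^ k) u)
          prog (initial_memory h j) t s,
        (t <= a * (n + m + L + T).+1 ^ k)%N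
      & outputs s (pi h j)].

End Semantics.

(* Main.v *)
Require Import Defs.
From mathcomp Require Import all_boot all_order all_algebra.
From mathcomp Require Import reals sequences.
From mathcomp Require Import exp archimedean.
From mathcomp Require Import zify ring lra.

Set Implicit Arguments.
Unset Strict Implicit.
Unset Printing Implicit Defensive.

Import Order.TTheory GRing.Theory Num.Theory.
Local Open Scope ring_scope.

(** No linear program is solved.  Let c' = min (c, T) for each product and
    warehouse.  Decisions that depend on the period and on the customer type
    only are computed backwards in time.  Together with the rule that a sale out
    of an empty warehouse is moved to the virtual one, the decisions for the last
    u periods have a value that splits into a sum of functions v^u of the single
    stocks.  For the period before, the stock is pretended to be c' - X, with X
    binomial of T-u-1 trials of mean c'/T.  Let q be the probability that a unit
    is left and theta the expected loss of v^u when one unit is lost; offer the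
    assortment that is best for the rewards max (0, max_l (r q - theta)).

    Any policy sells at most c' units of each kind, that is c'/T per period.  So
    the chosen decisions earn, net of theta, at least as much as the average
    decision of an optimal policy, and when u grows by one the expectation of
    v^u (c' - X) grows by at least q/T times the gain of the optimal policy.
    Summing over u, the value is at least the gain of the optimal policy times
    the mean of q over the periods, E min (Bin (T, c'/T), c') / c'.  This is at
    least 1 - 1 / (2 sqrt c) by a second moment bound, hence at least 1 - 1/e
    for c >= 2 since e <= 2 sqrt 2, and it is 1 - (1 - 1/T)^T for c = 1.

    The recursion for v^u uses the data and the discrete choices only, so
    denominators get multiplied by a bounded number of data per step and bit
    lengths stay polynomial. *)

(** * Random access machine programs *)

(** The number of steps must be bounded for arbitrary real data, independently of bit lengths; no
    polynomial bound of this kind is known for general linear programs, so the benchmark policy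
    enters the analysis only. The law of the pretended stock is fixed in advance by c' and T. A
    backward recursion could not use the true law, which depends on decisions for earlier periods
    that it has not reached yet. Values split over the stocks because neither the assortment nor the
    choice of the customer depends on the stock, and a diverted sale leaves every stock unchanged.
    The comparison replaces pretended periods by planned ones, one at a time: with none replaced the
    value is 0, with all replaced it is the value of the policy. A pretended period drains c'/T
    units on average at most, priced at theta; the competitor pays the same prices for at most as
    many units. Stationarity allows a single stage to be compared with all T periods of the
    competitor at once. *)

Notation sc a := ((a, [::]) : operand).

(** A step bound valid when every loop makes at most [N] iterations. Both branches of a conditional
    are added, a crude bound that keeps [cost] purely syntactic. *)
Fixpoint cost (N : nat) (c : cmd) : nat :=
  match c with
  | Seq c1 c2 => cost N c1 + cost N c2
  | IfNat _ _ c1 c2 | IfReal _ _ c1 c2 => (cost N c1 + cost N c2).+1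
  | While _ _ c => N * (cost N c).+1 + 1
  | _ => 1
  end%N.

Fixpoint csize (c : cmd) : nat :=
  match c with
  | Seq c1 c2 => csize c1 + csize c2
  | IfNat _ _ c1 c2 | IfReal _ _ c1 c2 => (csize c1 + csize c2).+1
  | While _ _ c => (csize c).+2
  | _ => 1
  end%N.

Fixpoint nesting (c : cmd) : nat :=
  match c with
  | Seq c1 c2 | IfNat _ _ c1 c2 | IfReal _ _ c1 c2 => maxn (nesting c1) (nesting c2)
  | While _ _ c => (nesting c).+1
  | _ => 0
  end%N.

(** Separates the program from the input: [csize] and [nesting] depend on the program only and
    become the uniform constants of the final polynomial. *)
Lemma cost_le N c : (cost N c <= csize c * N.+1 ^ nesting c)%N.
Proof.
have two c1 c2 : (cost N c1 <= csize c1 * N.+1 ^ nesting c1)%N ->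
    (cost N c2 <= csize c2 * N.+1 ^ nesting c2)%N ->
    (cost N c1 + cost N c2 <=
       (csize c1 + csize c2) * N.+1 ^ maxn (nesting c1) (nesting c2))%N.
  move=> h1 h2; rewrite mulnDl; apply: leq_add.
    by apply: leq_trans h1 _; rewrite leq_mul2l leq_pexp2l ?leq_maxl ?orbT.
  by apply: leq_trans h2 _; rewrite leq_mul2l leq_pexp2l ?leq_maxr ?orbT.
have e0 k : (0 < N.+1 ^ k)%N by rewrite expn_gt0.
elim: c => //= [c1 IH1 c2 IH2|y z c1 IH1 c2 IH2|y z c1 IH1 c2 IH2|y z c IH].
- exact: two.
- by rewrite mulSn -add1n leq_add ?two.
- by rewrite mulSn -add1n leq_add ?two.
- have := e0 (nesting c); rewrite expnS; move: (N.+1 ^ _)%N IH => E IH E0.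
  by nia.
Qed.

(** [For v v1 y c] runs [c] for [v = 0, 1, .., y - 1], with [v1 = v + 1];
    the scalars 11 and 12 contain 1 and 0. *)
Definition For (v v1 y : nat) (c : cmd) : cmd :=
  Seq (NConst (sc v) 0)
    (While (sc v) (sc y)
       (Seq (NOp NAdd (sc v1) (sc v) (sc 11))
         (Seq c (NOp NAdd (sc v) (sc v1) (sc 12))))).

Inductive rexp :=
| Cell of operand
| OfNat of operand
| Const of int
| Bin of realop & rexp & rexp.

(** Intermediate results are stored in the real scalars from 100 on. *)
Definition place (d : nat) (e : rexp) : operand :=
  if e is Cell x then x else sc d.

Fixpoint code (d : nat) (e : rexp) : cmd :=
  match e with
  | Cell _ => Skip
  | OfNat x => ROfNat (sc d) x
  | Const k => RConst (sc d) k
  | Bin o a b => Seq (Seq (code d a) (code d.+1 b)) (ROp o (sc d) (place d a) (place d.+1 b))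
  end.

(** There is no instruction copying a real cell, so the value is moved by adding the 0 kept in
    scalar 100; temporaries therefore start at 101. *)
Definition Assign (x : operand) (e : rexp) : cmd :=
  Seq (code 101 e) (Seq (RConst (sc 100) 0) (ROp RAdd x (place 101 e) (sc 100))).

(** * Total-correctness rules with step and size bounds *)

Section Wp.
Variables (R : realType) (n m L T : nat) (P : problem R n m L T) (O : oracle R n m).
Variables (ok : R -> Prop) (N : nat).
Implicit Types (s : memory R) (x y z : operand) (c : cmd) (Q : memory R -> Prop).

(** Halting, the step bound and the condition [ok] on every written real travel together with the
    postcondition. Since the bound is the syntactic [cost], the rules need no bookkeeping of
    time. *)
Definition wp c s Q : Prop :=
  exists s' t, [/\ exec P O ok c s t s', (t <= cost N c)%N & Q s'].

Lemma wp_seq c1 c2 s Q : wp c1 s (fun s' => wp c2 s' Q) -> wp (Seq c1 c2) s Q.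
Proof.
move=> [s1 [t1 [e1 l1 [s2 [t2 [e2 l2 q]]]]]].
exists s2, (t1 + t2)%N; split=> //; last by rewrite /= leq_add.
exact: ExecSeq e1 e2.
Qed.

Lemma wp_if_nat y z c1 c2 s Q :
  ((nval s y < nval s z)%N -> wp c1 s Q) ->
  ((nval s z <= nval s y)%N -> wp c2 s Q) -> wp (IfNat y z c1 c2) s Q.
Proof.
move=> h1 h2; have : wp (if (nval s y < nval s z)%N then c1 else c2) s Q.
  by case: ltnP.
move=> [s' [t [e l q]]]; exists s', t.+1; split=> //; first exact: ExecIfNat.
rewrite /= ltnS; apply: leq_trans l _.
by case: ifP => _; rewrite ?leq_addl ?leq_addr.
Qed.

Lemma wp_if_real y z c1 c2 s Q :
  (rval s y <= rval s z -> wp c1 s Q) ->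
  (rval s z < rval s y -> wp c2 s Q) -> wp (IfReal y z c1 c2) s Q.
Proof.
move=> h1 h2; have : wp (if rval s y <= rval s z then c1 else c2) s Q.
  by case: leP.
move=> [s' [t [e l q]]]; exists s', t.+1; split=> //; first exact: ExecIfReal.
rewrite /= ltnS; apply: leq_trans l _.
by case: ifP => _; rewrite ?leq_addl ?leq_addr.
Qed.

Lemma wp_basic c s s' Q : exec P O ok c s 1 s' -> cost N c = 1%N -> Q s' -> wp c s Q.
Proof. by move=> e k q; exists s', 1%N; rewrite k. Qed.

(** Scalars with known contents, kept as a literal list so that [look] and the side conditions
    reduce by computation. *)
Definition env := seq (nat * nat).
Implicit Types E : env.

Definition agree E s := forall p, p \in E -> nmem s (p.1, [::]) = p.2.

Fixpoint look E (v : nat) : nat :=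
  if E is (a, k) :: E' then if a == v then k else look E' v else 0%N.

Definition bound E (x : operand) := all [in unzip1 E] x.2.
(** The address is computed from the known scalars and not from the memory, so it stays the same
    cell while the memory changes. *)
Definition eloc E x : cell := (x.1, [seq look E v | v <- x.2]).

Lemma look_mem E v : v \in unzip1 E -> (v, look E v) \in E.
Proof.
elim: E => //= -[a k] E IH /=; rewrite !inE eq_sym.
case: (eqVneq a v) => [->|ne /=]; first by rewrite eqxx.
by move=> /IH ->; rewrite orbT.
Qed.

Lemma look_agree E s v : agree E s -> v \in unzip1 E -> nmem s (v, [::]) = look E v.
Proof. by move=> a /look_mem /a. Qed.

Lemma loc_env E s x : agree E s -> bound E x -> loc s x = eloc E x.
Proof.
move=> a /allP b; congr (_, _); apply/eq_in_map => v /b h.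
exact: look_agree.
Qed.

Definition nbound E x := bound E x && ((x.2 != [::]) || (x.1 \in unzip1 E)).
Definition enval E s x : nat := if x.2 is [::] then look E x.1 else nmem s (eloc E x).

Lemma nval_env E s x : agree E s -> nbound E x -> nval s x = enval E s x.
Proof.
move=> a /andP[b]; rewrite /nval (loc_env a b) /enval /eloc.
by case: x b => x1 [|? ?] //= _; apply: look_agree.
Qed.

Lemma agree_cons E s v k : v \notin unzip1 E -> agree E s ->
  agree ((v, k) :: E) (nwrite s (sc v) k).
Proof.
move=> nv a p; rewrite inE => /orP[/eqP-> /=|pE]; first by rewrite /loc /= eqxx.
rewrite /= /loc /= xpair_eqE; case: eqP => [e|_] /=; last exact: a.
by case/negP: nv; rewrite -e map_f.
Qed.

Lemma agree_cons2 E s v v1 k k1 : agree ((v, k) :: (v1, k1) :: E) s -> agree E s.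
Proof. by move=> a p pE; apply: a; rewrite !inE pE !orbT. Qed.

Lemma agree_sub E E' s : {subset E' <= E} -> agree E s -> agree E' s.
Proof. by move=> h a p /h /a. Qed.

Lemma agree_nmem E s s' : nmem s' = nmem s -> agree E s -> agree E s'.
Proof. by move=> e a p; rewrite e; apply: a. Qed.

(** The intended contents of the cells; [None] stands for no intention. *)
Record model := Model { mn : cell -> option nat; mr : cell -> option R }.
Variable M : model.

Definition kn s (u : cell) : Prop := if mn M u is Some v then nmem s u = v else True.
Definition kr s (u : cell) : Prop := if mr M u is Some v then rmem s u = v else True.

(** A program that writes nothing but intended contents preserves what is known
    about the arrays, whatever else it does: this replaces frame conditions. *)
Definition grows s s' : Prop :=
  (forall u, kn s u -> kn s' u) /\ (forall u, kr s u -> kr s' u).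

(** Loop variables and temporaries are overwritten with varying values, so no contents are intended
    for them; what is known about scalars is in the environment instead. *)
Hypothesis mn_scalar : forall a, mn M (a, [::]) = None.
Hypothesis mr_temp : forall a u, (100 <= a)%N -> mr M (a, u) = None.

Lemma grows_refl s : grows s s. Proof. by []. Qed.

Lemma grows_trans s1 s2 s3 : grows s1 s2 -> grows s2 s3 -> grows s1 s3.
Proof. by move=> [n1 r1] [n2 r2]; split=> u; [move/n1/n2|move/r1/r2]. Qed.

Lemma grows_scalar s v k : grows s (nwrite s (sc v) k).
Proof.
split=> // u; rewrite /kn /= /loc /=; case: eqP => // ->.
by rewrite mn_scalar.
Qed.

Lemma wp_scalar E s c v k Q :
  exec P O ok c s 1 (nwrite s (sc v) k) -> cost N c = 1%N ->
  agree E s -> v \notin unzip1 E ->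
  (forall s', agree ((v, k) :: E) s' -> grows s s' -> Q s') -> wp c s Q.
Proof.
move=> e1 c1 a nv q; apply: wp_basic e1 c1 _; apply: q.
  exact: agree_cons.
exact: grows_scalar.
Qed.

Lemma wp_nwrite E s c x k Q :
  exec P O ok c s 1 (nwrite s x k) -> cost N c = 1%N ->
  agree E s -> bound E x -> x.2 != [::] ->
  (if mn M (eloc E x) is Some v then k = v else True) ->
  (forall s', agree E s' -> grows s s' -> kn s' (eloc E x) -> Q s') -> wp c s Q.
Proof.
move=> e1 c1 a b nx h q; apply: wp_basic e1 c1 _; apply: q.
- move=> p pE; rewrite /= (loc_env a b) /eloc xpair_eqE.
  by case: (x.2) nx => //= *; rewrite andbF; exact: a.
- split=> // u; rewrite /kn /= (loc_env a b); case: eqP => // ->.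
  by move: h; case: (mn M _) => // ? <-.
- by rewrite /kn /= (loc_env a b) eqxx.
Qed.

Lemma wp_rwrite E s c x k Q :
  exec P O ok c s 1 (rwrite s x k) -> cost N c = 1%N ->
  agree E s -> bound E x ->
  (if mr M (eloc E x) is Some v then k = v else True) ->
  (forall s', agree E s' -> grows s s' -> kr s' (eloc E x) -> Q s') -> wp c s Q.
Proof.
move=> e1 c1 a b h q; apply: wp_basic e1 c1 _; apply: q => //.
- split=> // u; rewrite /kr /= (loc_env a b); case: eqP => // ->.
  by move: h; case: (mr M _) => // ? <-.
- by rewrite /kr /= (loc_env a b) eqxx.
Qed.

Lemma wp_nop E s o x y z Q :
  agree E s -> [&& bound E x, nbound E y, nbound E z & x.2 != [::]] ->
  (if mn M (eloc E x) is Some v then nat_op o (enval E s y) (enval E s z) = v else True) ->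
  (forall s', agree E s' -> grows s s' -> kn s' (eloc E x) -> Q s') -> wp (NOp o x y z) s Q.
Proof.
move=> a /and4P[bx bsy bz nx]; rewrite -!(nval_env a) // => h q.
by apply: (wp_nwrite (ExecNOp _ _ _ _ _ _ _ _)) q.
Qed.

Lemma wp_nop_scalar E s o v k y z Q :
  agree E s -> [&& v \notin unzip1 E, nbound E y & nbound E z] ->
  nat_op o (enval E s y) (enval E s z) = k ->
  (forall s', agree ((v, k) :: E) s' -> grows s s' -> Q s') -> wp (NOp o (sc v) y z) s Q.
Proof.
move=> a /and3P[nv bsy bz]; rewrite -!(nval_env a) // => <- q.
by apply: (wp_scalar (ExecNOp _ _ _ _ _ _ _ _)) q.
Qed.

Lemma wp_nconst E s v k Q :
  agree E s -> v \notin unzip1 E ->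
  (forall s', agree ((v, k) :: E) s' -> grows s s' -> Q s') -> wp (NConst (sc v) k) s Q.
Proof.
by move=> a nv q; apply: (@wp_scalar E s _ v k) => //; exact: ExecNConst.
Qed.

Lemma wp_ifn E s y z c1 c2 Q :
  agree E s -> nbound E y && nbound E z ->
  ((enval E s y < enval E s z)%N -> wp c1 s Q) ->
  ((enval E s z <= enval E s y)%N -> wp c2 s Q) -> wp (IfNat y z c1 c2) s Q.
Proof.
by move=> a /andP[bsy bz]; rewrite -!(nval_env a) // => h1 h2; apply: wp_if_nat.
Qed.

Lemma wp_ifr E s y z c1 c2 Q :
  agree E s -> bound E y && bound E z ->
  (rmem s (eloc E y) <= rmem s (eloc E z) -> wp c1 s Q) ->
  (rmem s (eloc E z) < rmem s (eloc E y) -> wp c2 s Q) -> wp (IfReal y z c1 c2) s Q.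
Proof.
move=> a /andP[bsy bz]; rewrite -!(loc_env a) // => h1 h2; exact: wp_if_real.
Qed.

(** The invariant has to survive growth of the memory, because the counter updates around the body
    change the memory too. The body knows both [v] and its successor: operands are indexed by
    scalars, without arithmetic. *)
Lemma wp_for E s (v v1 y Y : nat) c (I : nat -> memory R -> Prop) Q :
  [&& uniq [:: v, v1 & unzip1 E], y \in unzip1 E, 11%N \in unzip1 E & 12%N \in unzip1 E] ->
  look E y = Y -> look E 11 = 1%N -> look E 12 = 0%N -> (Y <= N)%N ->
  agree E s ->
  (forall k s1 s2, grows s1 s2 -> I k s1 -> I k s2) ->
  I 0%N s ->
  (forall k s1, (k < Y)%N -> agree [:: (v, k), (v1, k.+1) & E] s1 -> grows s s1 ->
     I k s1 ->
     wp c s1 (fun s2 => [/\ agree [:: (v, k), (v1, k.+1) & E] s2, grows s1 s2 & I k.+1 s2])) ->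
  (forall s', agree E s' -> grows s s' -> I Y s' -> Q s') ->
  wp (For v v1 y c) s Q.
Proof.
move=> /and4P[u iy i11 i12] ey e11 e12 YN a mono I0 body q; apply: wp_seq.
have [nv nv1 uE vv1] : [/\ v \notin unzip1 E, v1 \notin unzip1 E, uniq (unzip1 E) & v != v1].
  by move: u; rewrite /= !inE negb_or -!andbA => /and4P[-> -> -> ->].
have yE : (y, Y) \in E by rewrite -ey; exact: look_mem.
have oE : (11, 1)%N \in E by have := look_mem i11; rewrite e11.
have zE : (12, 0)%N \in E by have := look_mem i12; rewrite e12.
apply: (@wp_scalar E _ _ v 0%N) => //; first exact: ExecNConst.
move=> s0 a0 g0.
(* Induction on the number [d] of iterations left; each costs the body plus three steps, one for the
   test and two for the counters. *)
suff loop : forall d s1 k, k + d = Y -> agree ((v, k) :: E) s1 -> grows s s1 -> I k s1 ->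
    exists s' t, [/\ exec P O ok (While (sc v) (sc y)
       (Seq (NOp NAdd (sc v1) (sc v) (sc 11))
         (Seq c (NOp NAdd (sc v) (sc v1) (sc 12))))) s1 t s',
       (t <= d * (cost N c).+3 + 1)%N & [/\ agree E s', grows s s' & I Y s']].
  have [s' [t [e l [? ? ?]]]] := loop Y s0 0%N erefl a0 g0 (mono _ _ _ g0 I0).
  exists s', t; split=> //; last exact: q.
  apply: leq_trans l _; rewrite /= leq_add2r.
  by rewrite addn1 add1n leq_mul2r YN orbT.
have nvE s1 k E' : agree ((v, k) :: E') s1 -> nval s1 (sc v) = k.
  by move=> a1; apply: (a1 (v, k)); rewrite mem_head.
have sub1 s1 p : agree (p :: E) s1 -> agree E s1.
  by apply: agree_sub => ? h; rewrite inE h orbT.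
elim=> [|d IH] s1 k kd a1 g1 I1.
  exists s1, 1%N; split=> //.
    apply: ExecWhileStop; rewrite (nvE _ _ _ a1).
    by have -> : nval s1 (sc y) = Y by [exact: (sub1 _ _ a1 (y, Y))]; lia.
  split=> //; first exact: sub1 a1.
  by have <- : k = Y by lia.
have kY : (k < Y)%N by lia.
have yv : nval s1 (sc y) = Y by exact: (sub1 _ _ a1 (y, Y)).
pose s2 := nwrite s1 (sc v1) (nat_op NAdd (nval s1 (sc v)) (nval s1 (sc 11))).
have v2 : nat_op NAdd (nval s1 (sc v)) (nval s1 (sc 11)) = k.+1.
  by rewrite (nvE _ _ _ a1) (_ : nval s1 (sc 11) = 1%N) /= ?addn1 //; apply: (sub1 _ _ a1 (11, 1)%N).
have a2 : agree [:: (v, k), (v1, k.+1) & E] s2.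
  have : agree [:: (v1, k.+1), (v, k) & E] s2.
    rewrite /s2 v2; apply: agree_cons a1.
    by rewrite /= inE negb_or eq_sym vv1.
  by apply: agree_sub => p; rewrite !inE orbCA.
have g2 : grows s1 s2 by rewrite /s2; exact: grows_scalar.
have [s3 [t3 [e3 l3 [a3 g3 I3]]]] := body k s2 kY a2 (grows_trans g1 g2) (mono _ _ _ g2 I1).
pose s4 := nwrite s3 (sc v) (nat_op NAdd (nval s3 (sc v1)) (nval s3 (sc 12))).
have v4 : nat_op NAdd (nval s3 (sc v1)) (nval s3 (sc 12)) = k.+1.
  rewrite (_ : nval s3 (sc 12) = 0%N) /= ?addn0; last exact: (agree_cons2 a3 zE).
  by apply: (a3 (v1, k.+1)); rewrite !inE eqxx orbT.
have a4 : agree ((v, k.+1) :: E) s4.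
  by rewrite /s4 v4; apply: agree_cons => //; apply: agree_cons2 a3.
have g4 : grows s3 s4 by exact: grows_scalar.
have [s5 [t5 [e5 l5 r5]]] := IH s4 k.+1 (etrans (addSnnS _ _) kd) a4
  (grows_trans g1 (grows_trans g2 (grows_trans g3 g4))) (mono _ _ _ g4 I3).
exists s5, (1 + (t3 + 1) + t5).+1; split=> //.
  apply: ExecWhileStep (e5); first by rewrite (nvE _ _ _ a1) yv.
  apply: ExecSeq (ExecNOp _ _ _ _ _ _ _ _) _.
  exact: ExecSeq e3 (ExecNOp _ _ _ _ _ _ _ _).
rewrite mulSn; lia.
Qed.

Fixpoint below (d : nat) (e : rexp) : bool :=
  match e with
  | Cell x => (x.1 < d)%N
  | Bin _ a b => below d a && below d b
  | _ => true
  end.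

Fixpoint scoped E (e : rexp) : bool :=
  match e with
  | Cell x => bound E x
  | OfNat x => nbound E x
  | Const _ => true
  | Bin _ a b => scoped E a && scoped E b
  end.

Definition erval E s x : R := rmem s (eloc E x).

Fixpoint eval E s (e : rexp) : R :=
  match e with
  | Cell x => erval E s x
  | OfNat x => (enval E s x)%:R
  | Const k => k%:~R
  | Bin o a b => real_op o (eval E s a) (eval E s b)
  end.

Fixpoint okay E s (e : rexp) : Prop :=
  match e with
  | Cell x => True
  | OfNat x => ok (enval E s x)%:R
  | Const k => ok k%:~R
  | Bin o a b => [/\ okay E s a, okay E s b & ok (real_op o (eval E s a) (eval E s b))]
  end.

Lemma eval_below E s s' d e : below d e -> nmem s' = nmem s ->
  (forall u, (u.1 < d)%N -> rmem s' u = rmem s u) ->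
  eval E s' e = eval E s e /\ (okay E s' e = okay E s e).
Proof.
move=> + hn hr; elim: e => //= [x|x _|o e1 IH1 e2 IH2 /andP[/IH1[-> ->] /IH2[-> ->]] //].
- by move=> h; split=> //; rewrite /erval hr.
- by rewrite /enval hn.
Qed.

(** Expressions read cells of arrays below 100 and scratch scalars from [d] on. Hence evaluating the
    left operand does not disturb the cells read by the right one, and the right one, working from
    [d.+1], does not destroy the left result. *)
Lemma code_wp E d e s : (100 <= d)%N -> below 100 e -> scoped E e -> agree E s -> okay E s e ->
  exists s' t, [/\ exec P O ok (code d e) s t s', (t <= cost N (code d e))%N,
    nmem s' = nmem s, forall u, (u.1 < d)%N -> rmem s' u = rmem s u &
    rval s' (place d e) = eval E s e].
Proof.
elim: e d s => /= [x|x|k|o e1 IH1 e2 IH2] d s d100 be sE a ke.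
- exists s, 1%N; split=> //; first exact: ExecSkip.
  by rewrite /rval (loc_env a sE).
- exists (rwrite s (sc d) (nval s x)%:R), 1%N.
  have nx : nval s x = enval E s x by exact: nval_env a sE.
  split=> //.
  + by apply: ExecROfNat; rewrite nx.
  + by move=> u ud; rewrite /= /loc /=; case: eqP => // eu; rewrite eu /= ltnn in ud.
  + by rewrite /rval /= /loc /= eqxx nx.
- exists (rwrite s (sc d) k%:~R), 1%N; split=> //.
  + exact: ExecRConst.
  + by move=> u ud; rewrite /= /loc /=; case: eqP => // eu; rewrite eu /= ltnn in ud.
  + by rewrite /rval /= /loc /= eqxx.
move: be sE ke => /andP[b1 b2] /andP[sc1 sc2] [k1 k2 k3].
have [s1 [t1 [x1 l1 n1 r1 v1]]] := IH1 d s d100 b1 sc1 a k1.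
have a1 : agree E s1 by apply: agree_nmem a.
have [ev2 ok2] : eval E s1 e2 = eval E s e2 /\ (okay E s1 e2 = okay E s e2).
  by apply: (@eval_below E s s1 100) => // u u100; apply: r1; apply: leq_trans d100.
have [||s2 [t2 [x2 l2 n2 r2 v2]]] := IH2 d.+1 s1 _ b2 sc2 a1.
- exact: leq_trans (leqnSn _).
- by rewrite ok2.
have v1' : rval s2 (place d e1) = eval E s e1.
  rewrite -v1 /rval /loc n2; apply: r2 => /=.
  by case: (e1) b1 => //= x xd; apply: leq_trans xd (leq_trans d100 (leqnSn _)).
exists (rwrite s2 (sc d) (real_op o (rval s2 (place d e1)) (rval s2 (place d.+1 e2)))).
exists (t1 + t2 + 1)%N; split.
- apply: ExecSeq (ExecSeq x1 x2) _; apply: ExecROp.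
  by rewrite v1' v2 ev2.
- by lia.
- by rewrite /= n2 n1.
- move=> u ud; rewrite /= /loc /=; case: eqP => [eu|_]; first by rewrite eu /= ltnn in ud.
  by rewrite r2 ?r1 //; exact: leq_trans (leqnSn _).
- by rewrite /rval /= /loc /= eqxx -/(rval _ _) -/(rval _ _) v1' v2 ev2.
Qed.

Lemma wp_assign E s x e Q :
  agree E s -> bound E x -> scoped E e -> below 100 e -> okay E s e ->
  ok 0 -> ok (eval E s e) ->
  (if mr M (eloc E x) is Some v then eval E s e = v else True) ->
  (forall s', agree E s' -> grows s s' -> kr s' (eloc E x) -> Q s') ->
  wp (Assign x e) s Q.
Proof.
move=> a bx se be ke ok0 oke mx q; apply: wp_seq.
have [s1 [t1 [e1 l1 n1 r1 v1]]] := code_wp (isT : 100 <= 101)%N be se a ke.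
exists s1, t1; split=> //.
have a1 : agree E s1 by apply: agree_nmem a.
have g1 : grows s s1.
  split=> u; first by rewrite /kn n1.
  rewrite /kr; case: (ltnP u.1 100) => hu; first by rewrite r1 //; apply: leq_trans (leqnSn _).
  by case: u hu => u1 u2 hu; rewrite mr_temp.
pose s2 := rwrite s1 (sc 100) (0%:~R : R).
have h100 u : u.1 != 100%N -> rmem s2 u = rmem s1 u.
  by move=> hu; rewrite /= /loc /=; case: eqP => // eu; rewrite eu eqxx in hu.
have v2 : rval s2 (place 101 e) = eval E s e.
  rewrite -v1 /rval; apply: h100 => /=.
  by case: (e) be => //= y; rewrite ltn_neqAle => /andP[].
have a2 : agree E s2 by apply: agree_nmem a1.
have g2 : grows s1 s2.
  by split=> // u; rewrite /kr; case: (eqVneq u.1 100%N) => [|/h100->//]; case: u => u1 u2 /= ->; rewrite mr_temp.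
apply: wp_seq; apply: wp_basic (_ : cost N _ = 1%N) _ => //.
  by apply: (@ExecRConst _ _ _ _ _ _ _ _ s1 (sc 100) 0).
have ve : real_op RAdd (rval s2 (place 101 e)) (rval s2 (sc 100)) = eval E s e.
  by rewrite v2; exact: addr0.
rewrite -/s2; apply: (@wp_rwrite E _ _ x (eval E s e)) => //.
- by rewrite -ve; apply: ExecROp; rewrite ve.
- by move=> s' a' g'; apply: q => //; apply: grows_trans g1 (grows_trans g2 g').
Qed.

End Wp.

(** * The sold fraction of a stock *)

Lemma at_indexE V (v0 : V) n (F : 'I_n -> V) (i : 'I_n) : at_index v0 F i = F i.
Proof. by rewrite /at_index valK. Qed.

Lemma at_index_ltn V (v0 : V) n (F : 'I_n -> V) i (h : (i < n)%N) :
  at_index v0 F i = F (Ordinal h).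
Proof. by rewrite -(at_indexE v0). Qed.

Section Smooth.
Variable R : realType.
Implicit Types (p : R) (g : nat -> R).

(** The expectation of g after one period of a demand of 0 or 1, with mean p,
    for the stock x. *)
Definition smooth p g (x : nat) : R := (1 - p) * g x + p * g x.-1.

Lemma smooth_lin p g g' a x :
  smooth p (fun x => g x + a * g' x) x = smooth p g x + a * smooth p g' x.
Proof. by rewrite /smooth; ring. Qed.

Lemma eq_smooth p g g' : g =1 g' -> smooth p g =1 smooth p g'.
Proof. by move=> e x; rewrite /smooth !e. Qed.

Lemma eq_iter_smooth p g g' s : g =1 g' -> iter s (smooth p) g =1 iter s (smooth p) g'.
Proof. by move=> e; elim: s => //= s IH; apply: eq_smooth. Qed.

Lemma iter_smooth_lin p g g' a s x :
  iter s (smooth p) (fun x => g x + a * g' x) x =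
  iter s (smooth p) g x + a * iter s (smooth p) g' x.
Proof.
elim: s x => //= s IH x; rewrite (eq_smooth _ IH); exact: smooth_lin.
Qed.

Lemma iter_smooth_pred p g s x :
  iter s (smooth p) (fun x => g x.-1) x = iter s (smooth p) g x.-1.
Proof. by elim: s x => //= s IH x; rewrite /smooth !IH. Qed.

(** One more period of demand costs [p] times the expected loss from one missing unit. For the stock
    itself this makes the availabilities telescope; for a value function it is the price of the
    drift. *)
Lemma iter_smoothS p g s x :
  iter s.+1 (smooth p) g x =
  iter s (smooth p) g x - p * (iter s (smooth p) g x - iter s (smooth p) g x.-1).
Proof. by rewrite /= /smooth; ring. Qed.

Lemma iter_smooth0 p g s : g 0%N = 0 -> iter s (smooth p) g 0%N = 0.
Proof. by move=> g0; elim: s => //= s IH; rewrite /smooth IH !mulr0 addr0. Qed.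

Lemma iter_smooth_mono p g s x : 0 <= p <= 1 -> (forall x, g x.-1 <= g x) ->
  iter s (smooth p) g x.-1 <= iter s (smooth p) g x.
Proof.
move=> /andP[p0 p1] h; elim: s x => //= s IH x.
by rewrite /smooth lerD // ler_wpM2l // subr_ge0.
Qed.

Lemma iter_smooth_ge0 p g s x : 0 <= p <= 1 -> (forall x, 0 <= g x) ->
  0 <= iter s (smooth p) g x.
Proof.
move=> /andP[p0 p1] h; elim: s x => //= s IH x.
by rewrite /smooth addr_ge0 // mulr_ge0 // subr_ge0.
Qed.

Lemma iter_smooth_le p g M s x : 0 <= p <= 1 -> (forall x, g x <= M) ->
  iter s (smooth p) g x <= M.
Proof.
move=> /andP[p0 p1] h; elim: s x => //= s IH x.
have -> : M = (1 - p) * M + p * M by ring.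
by rewrite /smooth lerD // ler_wpM2l // subr_ge0.
Qed.

Lemma iter_smooth_le_nat p s x : 0 <= p <= 1 -> iter s (smooth p) (fun x => x%:R) x <= x%:R.
Proof.
move=> /andP[p0 p1]; elim: s x => //= s IH x; rewrite /smooth.
have := IH x; have := IH x.-1; move: (iter _ _ _ _) (iter _ _ _ _) => a b ha hb.
have h : x.-1%:R <= x%:R :> R by rewrite ler_nat leq_pred.
by nra.
Qed.

(** Quadratic majorant of the expected remaining stock: it comes from
    [2 y^+ <= y + (y^2 / a + a) / 2] and the mean [x - s p] and variance
    [s p (1 - p)] of [y]. *)
Lemma iter_smooth_quad p s x (a : R) : 0 <= p <= 1 -> 0 < a ->
  iter s (smooth p) (fun x => x%:R) x <=
  (x%:R - s%:R * p + ((x%:R - s%:R * p) ^+ 2 + s%:R * p * (1 - p)) / (2 * a) + a / 2) / 2.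
Proof.
move=> /andP[p0 p1] a0.
have pos (y w : R) : 0 <= w -> 0 <= (y + (y ^+ 2 + w) / (2 * a) + a / 2) / 2.
  move=> w0; have -> : (y + (y ^+ 2 + w) / (2 * a) + a / 2) / 2 =
    ((y + a) ^+ 2 + w) / (4 * a) by field; rewrite gt_eqF.
  by rewrite divr_ge0 ?addr_ge0 ?sqr_ge0 // mulr_ge0 // ltW.
elim: s x => [|s IH] [|x].
- by have := pos 0 0 (lexx _); rewrite !mul0r subrr expr0n /= addr0 => h; exact: h.
- rewrite /=; move: (x.+1%:R) => y; rewrite !mul0r subr0 addr0 -subr_ge0.
  have -> : (y + y ^+ 2 / (2 * a) + a / 2) / 2 - y = (y - a) ^+ 2 / (4 * a).
    by field; rewrite gt_eqF.
  by rewrite divr_ge0 ?sqr_ge0 // mulr_ge0 // ltW.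
- by rewrite iter_smooth0 // pos // !mulr_ge0 // subr_ge0.
have -> : iter s.+1 (smooth p) (fun x => x%:R) x.+1 =
  (1 - p) * iter s (smooth p) (fun x => x%:R) x.+1 + p * iter s (smooth p) (fun x => x%:R) x by [].
apply: le_trans (lerD (ler_wpM2l _ (IH x.+1)) (ler_wpM2l p0 (IH x))) _.
  by rewrite subr_ge0.
(* For positive stock the majorant satisfies the recursion with equality. The truncation at 0
   matters at stock 0 only, where its nonnegativity, a completed square, was enough. *)
rewrite -![x.+1%:R]natr1 -![s.+1%:R]natr1 le_eqVlt; apply/orP; left; apply/eqP.
by field; rewrite gt_eqF.
Qed.

(** The 16th power of exp (-1/16) >= 15/16. The constant lies between 1 / (2 * 1.414), needed for
    stocks of at least 2, and (15/16)^16; the exponent 8 would be too coarse. *)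
Lemma expR1_ge : (expR 1 : R)^-1 >= 3557 / 10000.
Proof.
have h : (15 / 16 : R) <= expR (- (1 / 16)).
  by apply: le_trans (expR_ge1Dx _); lra.
have -> : (expR 1 : R)^-1 = expR (- (1 / 16)) ^+ 16.
  by rewrite -expRN -expRM_natl; congr expR; lra.
have e0 : 0 <= expR (- (1 / 16)) :> R by exact: expR_ge0.
apply: le_trans (lerXn2r 16 _ _ h); rewrite ?nnegrE //; last lra.
by rewrite (exprM _ 4 4) (exprM _ 2 2) (exprM _ 2 2); lra.
Qed.

(** rho is the expected fraction of the stock c that is sold in T periods with
    mean total demand c. *)
Lemma fill_rate (c T : nat) : (0 < c)%N -> (c <= T)%N ->
  let rho := 1 - iter T (smooth (c%:R / T%:R)) (fun x => x%:R) c / c%:R in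
  1 - (expR 1)^-1 <= rho /\ 1 - (Num.sqrt c%:R)^-1 <= rho.
Proof.
move=> c0 cT rho.
have T0 : (0 < T)%N by apply: leq_trans cT.
have cR : 0 < c%:R :> R by rewrite ltr0n.
have TR : 0 < T%:R :> R by rewrite ltr0n.
have sR : 0 < Num.sqrt c%:R :> R by rewrite sqrtr_gt0.
have p01 : 0 <= (c%:R / T%:R : R) <= 1.
  by rewrite divr_ge0 //= ler_pdivrMr // mul1r ler_nat.
(* The mean of the untruncated stock is 0 and its variance at most c, so the choice [a] = sqrt c in
   the quadratic majorant bounds the remaining stock by sqrt c / 2. *)
have bnd : iter T (smooth (c%:R / T%:R)) (fun x => x%:R) c / c%:R <= 1 / (2 * Num.sqrt c%:R) :> R.
  have := iter_smooth_quad T c p01 sR.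
  have -> : T%:R * (c%:R / T%:R) = c%:R :> R by field; rewrite gt_eqF.
  rewrite subrr expr0n /= !add0r => h; rewrite ler_pdivrMr //; apply: le_trans h _.
  move: p01 => /andP[+ _]; move: (c%:R / T%:R) => r r0.
  have := sqr_sqrtr (ltW cR); move: (Num.sqrt c%:R) sR => a a0 <-.
  have -> : (a ^+ 2 * (1 - r) / (2 * a) + a / 2) / 2 = a / 2 - r * a / 4.
    by field; rewrite gt_eqF.
  have -> : 1 / (2 * a) * a ^+ 2 = a / 2 by field; rewrite gt_eqF.
  by have := mulr_ge0 r0 (ltW a0); lra.
split; rewrite lerD2l lerN2; last first.
  apply: le_trans bnd _; rewrite invfM mul1r ler_piMl ?invr_ge0 ?sqrtr_ge0 //.
  by lra.
case: (eqVneq c 1%N) => [->|c1].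
  have e s : iter s (smooth (1%:R / T%:R : R)) (fun x => x%:R) 1%N = (1 - 1 / T%:R) ^+ s.
    elim: s => // s IH; rewrite exprS -IH /= {1}/smooth /=.
    by rewrite iter_smooth0 // mulr0 addr0.
  have -> : (expR 1 : R)^-1 = expR (- (1 / T%:R)) ^+ T.
    by rewrite -expRN -expRM_natl; congr expR; field; rewrite gt_eqF.
  rewrite e divr1; apply: lerXn2r; rewrite ?nnegrE ?expR_ge0 //; last exact: expR_ge1Dx.
  by rewrite subr_ge0 ler_pdivrMr // mul1r ler1n.
apply: le_trans bnd _; apply: le_trans expR1_ge.
have c2 : 2 <= c%:R :> R by rewrite ler_nat; lia.
have : Num.sqrt 2 <= Num.sqrt c%:R :> R by rewrite ler_sqrt // ltW.
have : 1414 / 1000 <= Num.sqrt 2 :> R.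
  have -> : 1414 / 1000 = Num.sqrt ((1414 / 1000) ^+ 2) :> R by rewrite sqrtr_sqr ger0_norm //; lra.
  by rewrite ler_sqrt; lra.
by move=> h1 h2; rewrite ler_pdivrMr ?mulr_gt0 //; lra.
Qed.

End Smooth.

(** * The policy and its value *)

Section Histories.
Variables (R : realType) (A : finType) (ep : seq A -> A -> R).
Implicit Types (h : seq A) (F G : seq A -> R).

Fixpoint expect k h F : R :=
  if k is k'.+1 then \sum_e ep h e * expect k' (rcons h e) F else F h.

(** Splitting a tuple into head and tail turns the sum over all tuples, as in the definition of the
    expected profit, into a recursion on the next event. *)
Lemma expect_tuple k h F :
  \sum_(w : k.-tuple A) (\prod_(t < k) ep (h ++ take t w) (tnth w t)) * F (h ++ w) =
  expect k h F.
Proof.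
elim: k h F => [|k IH] h F /=.
  rewrite (big_pred1 [tuple]) => [|w]; last by apply/esym/eqP; exact: tuple0.
  by rewrite big_ord0 mul1r cats0.
rewrite (reindex (fun p : A * k.-tuple A => [tuple of p.1 :: p.2])); last first.
  exists (fun w => (thead w, [tuple of behead w])) => [[a w] _|w _] /=.
    by congr (_, _); apply: val_inj.
  by rewrite [RHS]tuple_eta; apply: val_inj.
rewrite -(pair_bigA _ (fun a (w : k.-tuple A) =>
  (\prod_(t < k.+1) ep (h ++ take t (a :: w)) (tnth [tuple of a :: w] t)) * F (h ++ a :: w))) /=.
apply: eq_bigr => a _; rewrite -IH big_distrr /=; apply: eq_bigr => w _.
rewrite big_ord_recl /= ?take0 cats0 mulrA cat_rcons; congr (_ * _ * _).
apply: eq_bigr => t _; rewrite cat_rcons; congr ep.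
by rewrite !(tnth_nth a).
Qed.

Lemma eq_expect k h F G : F =1 G -> expect k h F = expect k h G.
Proof.
by move=> e; elim: k h => [|k IH] h /=; [apply: e|apply: eq_bigr => a _; rewrite IH].
Qed.

Lemma expectD k h F G : expect k h (fun h => F h + G h) = expect k h F + expect k h G.
Proof.
elim: k h => //= k IH h; rewrite -big_split; apply: eq_bigr => a _.
by rewrite IH mulrDr.
Qed.

Lemma expectZ k h c F : expect k h (fun h => c * F h) = c * expect k h F.
Proof.
elim: k h => //= k IH h; rewrite big_distrr; apply: eq_bigr => a _.
by rewrite IH mulrCA.
Qed.

Lemma expect_sum k h (I : finType) (F : I -> seq A -> R) :
  expect k h (fun h => \sum_i F i h) = \sum_i expect k h (F i).
Proof.
elim: k h => //= k IH h; rewrite exchange_big; apply: eq_bigr => a _ /=.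
by rewrite IH big_distrr.
Qed.

Hypothesis ep_ge0 : forall h e, 0 <= ep h e.
Hypothesis ep_sum : forall h, \sum_e ep h e = 1.

(** The comparison is needed only on histories reachable with positive probability; feasibility of a
    policy says something about these alone. *)
Lemma expect_le (Inv : seq A -> Prop) k h F G :
  (forall h e, Inv h -> 0 < ep h e -> Inv (rcons h e)) ->
  (forall h, Inv h -> F h <= G h) -> Inv h -> expect k h F <= expect k h G.
Proof.
move=> inv le; elim: k h => [|k IH] h ih /=; first exact: le.
apply: ler_sum => e _; have := ep_ge0 h e; rewrite le_eqVlt => /orP[/eqP<-|e0].
  by rewrite !mul0r.
by rewrite ler_wpM2l ?(ltW e0) // IH //; apply: inv.
Qed.

Lemma expect_cst k h c : expect k h (fun=> c) = c.
Proof.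
elim: k h => //= k IH h; under eq_bigr do rewrite IH.
by rewrite -big_distrl /= ep_sum mul1r.
Qed.

Lemma expect_size k h : expect k h (fun h => (size h)%:R) = (size h + k)%:R.
Proof.
elim: k h => [|k IH] h /=; first by rewrite addn0.
under eq_bigr do rewrite IH size_rcons addSnnS.
by rewrite -big_distrl /= ep_sum mul1r.
Qed.

(** A bound on one period that is uniform in the history is what disposes of history-dependent and
    randomized competitors. *)
Lemma expect_additive_le (a : A -> R) g k h :
  (forall h, \sum_e ep h e * a e <= g) ->
  expect k h (fun h => \sum_(e <- h) a e) <= \sum_(e <- h) a e + g *+ k.
Proof.
move=> le; elim: k h => [|k IH] h /=; first by rewrite mulr0n addr0.
apply: (@le_trans _ _ (\sum_e ep h e * (\sum_(e <- h) a e + g *+ k + a e))).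
  apply: ler_sum => e _; rewrite ler_wpM2l //; apply: le_trans (IH _) _.
  by rewrite -cats1 big_cat big_seq1 /= addrAC.
rewrite (eq_bigr _ (fun e _ => mulrDr _ _ _)) big_split /= -big_distrl /= ep_sum.
by rewrite mul1r mulrSr addrA lerD2l.
Qed.

End Histories.

(** * The plan, by backward recursion *)

Section Model.
Variables (R : realType) (n m L T : nat) (P : problem R n m L T) (O : oracle R n m).

(** Indices are natural numbers with a default outside the range, so that these functions can serve
    literally as the intended contents of the program's arrays. *)
Definition cap i l : nat := minn (array2 0%N (stock0 P) [:: i; l]) T.
Definition drift i l : R := (cap i l)%:R / T%:R.
Definition rew i j l : R := array3 0 (profit P) [:: i; j; l].
Definition arr j u : R := array2 0 (lam P) [:: j; u].
Definition left_stock i l s : nat -> R := iter s (smooth (drift i l)) (fun x => x%:R).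

(** The decisions for the period before the last u periods; v i l x is the
    value for these u periods of x units of product i in warehouse l. *)
Section Stage.
Variables (u : nat) (v : nat -> nat -> nat -> R).

Definition smooth_value i l s : nat -> R := iter s (smooth (drift i l)) (v i l).
(** The probability that a unit is left, and the expected cost of losing it,
    if the stock evolved with the drift [drift] up to the current period. *)
Definition avail i l : R :=
  left_stock i l (T - u.+1) (cap i l) - left_stock i l (T - u.+1) (cap i l).-1.
Definition price i l : R :=
  smooth_value i l (T - u.+1) (cap i l) - smooth_value i l (T - u.+1) (cap i l).-1.
Definition margin j i l : R := rew i j l * avail i l - price i l.

(** Warehouse l is encoded by l + 1 and the virtual warehouse by 0. *)
Fixpoint best j i k : R * nat :=
  if k is l.+1 then
    if margin j i l <= (best j i l).1 then best j i l else (margin j i l, l.+1)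
  else (0, 0%N).

Definition rewards j : {ffun 'I_n -> R} := [ffun i : 'I_n => (best j i L).1].
Definition offer j : {set 'I_n} := at_index set0 (fun j' => O j' (rewards j)) j.
Definition demand i j : R :=
  at_index 0 (fun i' => at_index 0 (fun j' => phi P i' j' (offer j)) j) i.
Definition rate j i : R := arr j u * demand i j.
Definition served j i l : bool := (best j i L).2 == l.+1.
(** The limit [k] gives a name to the partial sums that the program accumulates type by type; the
    full rate is at [k = m]. *)
Definition sale_rate k i l : R := \sum_(0 <= j < k) (if served j i l then rate j i else 0).
Definition gain_rate k i l : R :=
  \sum_(0 <= j < k) (if served j i l then rate j i * rew i j l else 0).
(** The rates do not depend on the stock as long as it is positive. At stock 0 all sales are
    diverted to the virtual warehouse, at profit 0. *)
Definition next_value i l x : R :=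
  if x is y.+1 then v i l x + (gain_rate m i l - sale_rate m i l * (v i l x - v i l y)) else 0.

End Stage.

Fixpoint value u : nat -> nat -> nat -> R :=
  if u is u'.+1 then next_value u' (value u') else fun _ _ _ => 0.

(** Only the last test looks at the stock, and it affects neither the assortment nor the other
    stocks; each single stock is thus a Markov chain of its own. *)
Definition plan u (x : 'I_n -> 'I_L -> nat) (j : nat) : decision n L :=
  (offer u (value u) j,
   [ffun i : 'I_n => if (best u (value u) j i L).2 is k.+1 then
      if insub k is Some l then if (0 < x i l)%N then Some l else None else None
    else None]).

(** [T - (size h).+1] counts the periods after the current one. Histories beyond the horizon, of
    which [feasible] speaks as well, fall back to stage 0. *)
Definition plan_policy : policy R n m L :=
  fun h j d => (d == plan (T - (size h).+1) (stock P h) j)%:R.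

Lemma plan_policy_feasible : feasible P plan_policy.
Proof.
move=> h j; rewrite /plan_policy; set d0 := plan _ _ _; split=> [d||d].
- by rewrite ler0n.
- by rewrite (bigD1 d0) //= eqxx big1 ?addr0 // => d /negPf->.
case: eqP => [->|]; last by rewrite ltxx.
move=> _ i l _; rewrite /d0 /plan ffunE.
case: (best _ _ _ _ _).2 => // k; case: insub => // l'; case: ltnP => // x0 [<-] //.
Qed.

Lemma best_le j i k u v : ((best u v j i k).2 <= k)%N.
Proof. by elim: k => //= l IH; case: ifP => //= _; apply: leq_trans IH _. Qed.

Lemma best_ge0 j i k u v : 0 <= (best u v j i k).1.
Proof.
by elim: k => //= l IH; case: (leP (margin _ _ _ _ _)) => //= h; apply: le_trans IH (ltW h).
Qed.

Lemma best_max j i k u v l : (l < k)%N -> margin u v j i l <= (best u v j i k).1.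
Proof.
elim: k => //= k IH; rewrite ltnS leq_eqVlt => /orP[/eqP->|/IH h].
  by case: (leP (margin _ _ _ _ _) (best _ _ _ _ _).1) => //=.
by case: (leP (margin _ _ _ _ k) (best _ _ _ _ _).1) => //= h'; apply: le_trans h (ltW h').
Qed.

Lemma best_margin j i k u v l : (best u v j i k).2 = l.+1 ->
  (best u v j i k).1 = margin u v j i l /\ 0 < margin u v j i l.
Proof.
elim: k => //= k IH; case: (leP (margin u v j i k) (best u v j i k).1) => // h [<-]; split=> //.
by apply: le_lt_trans h; apply: best_ge0.
Qed.

Lemma best_virtual j i k u v : (best u v j i k).2 = 0%N -> (best u v j i k).1 = 0.
Proof. by elim: k => //= k IH; case: ifP. Qed.

End Model.

Lemma at_index_ind V (Q : V -> Prop) (v0 : V) n (F : 'I_n -> V) i :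
  Q v0 -> (forall i, Q (F i)) -> Q (at_index v0 F i).
Proof. by rewrite /at_index; case: insub. Qed.

Lemma sum_option (V : zmodType) (A : finType) (F : option A -> V) :
  \sum_e F e = F None + \sum_a F (Some a).
Proof.
rewrite (bigD1 None) //=; congr (_ + _).
rewrite (reindex_omap Some id) //= => [|[]//].
by apply: eq_bigl => a; rewrite eqxx.
Qed.

Lemma sum_pair (V : zmodType) (A B : finType) (F : A * B -> V) :
  \sum_p F p = \sum_a \sum_b F (a, b).
Proof. by rewrite pair_bigA; apply: eq_bigr => -[]. Qed.

(** * One stage of the recursion and its gain *)

Section Value.
Variables (R : realType) (n m L T : nat) (P : problem R n m L T) (O : oracle R n m).
Hypotheses (arrP : arrival_probabilities P) (choiceP : choice_model P).
Hypotheses (statP : stationary P) (oracleP : assortment_oracle P O).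

Lemma drift01 i l : 0 <= drift P i l <= 1.
Proof.
rewrite /drift; case: (posnP T) => T0.
  by rewrite (_ : T%:R = 0) ?invr0 ?mulr0 ?lexx ?ler01 // [in LHS]T0.
by rewrite divr_ge0 //= ler_pdivrMr ?ltr0n // mul1r ler_nat geq_minr.
Qed.

Lemma arr_ge0 j u : 0 <= arr P j u.
Proof.
have [h _] := arrP; rewrite /arr /=.
by apply: (at_index_ind (Q := fun x => 0 <= x)) => // j'; apply: (at_index_ind (Q := fun x => 0 <= x)).
Qed.

Lemma arr_sum u : \sum_(j < m) arr P j u <= 1.
Proof.
have [_ h] := arrP; case: (ltnP u T) => uT.
  under eq_bigr do rewrite /arr /= at_indexE (at_index_ltn _ _ uT).
  exact: h.
rewrite big1 ?ler01 // => j _; rewrite /arr /= at_indexE /at_index insubF //.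
by rewrite ltnNge uT.
Qed.

(** The recursion indexes arrivals by the number of periods left instead of the period itself;
    stationarity makes the two interchangeable. *)
Lemma arr_stationary j (t : 'I_T) u : (u < T)%N -> arr P (j : 'I_m) u = lam P j t.
Proof. by move=> uT; rewrite /arr /= at_indexE (at_index_ltn _ _ uT). Qed.

Lemma avail_ge0 u i l : 0 <= avail P u i l.
Proof.
rewrite subr_ge0; apply: iter_smooth_mono (drift01 i l) _ => x.
by rewrite ler_nat leq_pred.
Qed.

Section Stage.
Variables (u : nat) (v : nat -> nat -> nat -> R).
Hypothesis v0 : forall i l, v i l 0%N = 0.
Hypothesis v_mono : forall i l x, v i l x.-1 <= v i l x.

Lemma price_ge0 i l : 0 <= price P u v i l.
Proof. by rewrite subr_ge0; apply: iter_smooth_mono (drift01 i l) _. Qed.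

Lemma demand_ge0 i j : 0 <= demand P O u v i j.
Proof.
have [h _ _ _] := choiceP.
by apply: (at_index_ind (Q := fun x => 0 <= x)) => // i'; apply: (at_index_ind (Q := fun x => 0 <= x)).
Qed.

Lemma demandE (i : 'I_n) (j : 'I_m) : demand P O u v i j = phi P i j (offer P O u v j).
Proof. by rewrite /demand !at_indexE. Qed.

Lemma rate_ge0 j i : 0 <= rate P O u v j i.
Proof. by rewrite mulr_ge0 ?arr_ge0 ?demand_ge0. Qed.

Lemma demand_le1 i j : demand P O u v i j <= 1.
Proof.
have [h h1 _ _] := choiceP.
apply: (at_index_ind (Q := fun x => x <= 1)) => // i'; apply: (at_index_ind (Q := fun x => x <= 1)) => // j'.
apply: le_trans (h1 j' (offer P O u v j)); rewrite (bigD1 i') //= lerDl.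
by apply: sumr_ge0 => *; exact: h.
Qed.

(** A warehouse is chosen only for a positive margin r q - theta; as q and theta are nonnegative, a
    negative r is impossible. *)
Lemma served_rew j i l : served P u v j i l -> 0 <= rew P i j l.
Proof.
move=> /eqP /best_margin[_]; rewrite /margin subr_gt0 => h.
have {}h := le_lt_trans (price_ge0 i l) h.
rewrite leNgt; apply/negP => r0; move: h; apply/negP; rewrite -leNgt.
by rewrite nmulr_rle0 ?avail_ge0.
Qed.

Lemma sale_rate01 i l : 0 <= sale_rate P O u v m i l <= 1.
Proof.
rewrite /sale_rate big_mkord; apply/andP; split.
  by apply: sumr_ge0 => j _; case: ifP => // _; apply: rate_ge0.
apply: le_trans (arr_sum u); apply: ler_sum => j _.
case: ifP => _; last exact: arr_ge0.
by rewrite /rate ler_piMr ?arr_ge0 ?demand_le1.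
Qed.

Lemma gain_rate_ge0 k i l : 0 <= gain_rate P O u v k i l.
Proof.
apply: sumr_ge0 => j _; case: ifP => // /served_rew r0.
by rewrite mulr_ge0 ?rate_ge0.
Qed.

Lemma next_valueE i l x : next_value P O u v i l x =
  v i l x + \sum_(j < m) (if served P u v j i l && (0 < x)%N
     then rate P O u v j i * (rew P i j l - (v i l x - v i l x.-1)) else 0).
Proof.
case: x => [|x] /=.
  by rewrite v0 big1 ?addr0 // => j _; rewrite andbF.
congr (_ + _); rewrite /gain_rate /sale_rate !big_mkord mulr_suml -sumrB.
by apply: eq_bigr => j _; rewrite andbT; case: served; ring.
Qed.

(** From stock 1 on, the gain cancels and an increment of [next_value] is a convex combination of
    two increments of [v], with the sale rate in [0, 1] as weight. From stock 0 to 1 the gain is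
    nonnegative. *)
Lemma next_value_mono i l x : next_value P O u v i l x.-1 <= next_value P O u v i l x.
Proof.
have /andP[s0 s1] := sale_rate01 i l; have g0 := gain_rate_ge0 m i l.
case: x => [|[|x]] //=; first by have := v_mono i l 1; rewrite /= v0; nra.
have /= := v_mono i l x.+1; have /= := v_mono i l x.+2.
move: (v i l x) (v i l x.+1) (v i l x.+2) => a b c; rewrite -!(subr_ge0 b) -(subr_ge0 a) => h1 h2.
have := mulr_ge0 s0 h2; have := mulr_ge0 (_ : 0 <= 1 - _) h1; last first.
by nra.
Qed.

(** The indicator of a positive stock is [x%:R - x.-1%:R], so [next_value] is a linear combination
    of [v], of the stock and of their shifts by [predn]; smoothing is linear and commutes with the
    shift. *)
Lemma next_value_smooth i l s x :
  iter s (smooth (drift P i l)) (next_value P O u v i l) x =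
  smooth_value P v i l s x +
  (gain_rate P O u v m i l * (left_stock P i l s x - left_stock P i l s x.-1) -
   sale_rate P O u v m i l * (smooth_value P v i l s x - smooth_value P v i l s x.-1)).
Proof.
set g := gain_rate _ _ _ _ _ _ _; set a := sale_rate _ _ _ _ _ _ _.
pose f x := v i l x + g * x%:R; pose f1 x := f x + (- g) * x.-1%:R.
pose f2 x := f1 x + (- a) * v i l x; pose f3 x := f2 x + a * v i l x.-1.
rewrite (@eq_iter_smooth _ _ _ f3); last first.
  case=> [|y]; rewrite /f3 /f2 /f1 /f /next_value; first by rewrite /= !v0; ring.
  by rewrite -/g -/a -natr1 /=; ring.
rewrite /f3 iter_smooth_lin /f2 iter_smooth_lin /f1 iter_smooth_lin /f iter_smooth_lin.
rewrite (iter_smooth_pred _ (fun x => x%:R)) (iter_smooth_pred _ (v i l)).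
by rewrite /left_stock /smooth_value; ring.
Qed.

Definition stage_gain : R :=
  \sum_(j < m) arr P j u * \sum_(i < n) demand P O u v i j * (best P u v j i L).1.

Lemma sum_served j i (F : nat -> R) : (forall l, served P u v j i l -> F l = (best P u v j i L).1) ->
  \sum_(l < L) (if served P u v j i l then F l else 0) = (best P u v j i L).1.
Proof.
move=> hF; case e: (best P u v j i L).2 => [|k].
  rewrite (best_virtual e) big1 // => l _; by rewrite /served e.
have kL : (k < L)%N by rewrite -e best_le.
have sk : served P u v j i k by rewrite /served e.
rewrite (bigD1 (Ordinal kL)) //= sk (hF _ sk).
rewrite big1 ?addr0 // => l; rewrite -val_eqE /= eq_sym => lk.
by rewrite /served e eqSS (negPf lk).
Qed.

(** Regroups by stock what the oracle maximizes by customer type; the summands are the increments in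
    [next_value_smooth]. *)
Lemma stage_gainE : stage_gain =
  \sum_(i < n) \sum_(l < L) (gain_rate P O u v m i l * avail P u i l -
                              sale_rate P O u v m i l * price P u v i l).
Proof.
transitivity (\sum_(j < m) \sum_(i < n) \sum_(l < L)
    (if served P u v j i l then rate P O u v j i * margin P u v j i l else 0)).
  apply: eq_bigr => j _; rewrite mulr_sumr; apply: eq_bigr => i _.
  rewrite mulrA -/(rate P O u v j i) -(sum_served (F := margin P u v j i)); last first.
    by move=> l /eqP /best_margin[].
  rewrite mulr_sumr; apply: eq_bigr => l _; by case: ifP; rewrite ?mulr0.
rewrite exchange_big; apply: eq_bigr => i _; rewrite exchange_big; apply: eq_bigr => l _ /=.
rewrite /gain_rate /sale_rate !big_mkord !mulr_suml -sumrB; apply: eq_bigr => j _.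
by case: served; rewrite ?mul0r ?subr0 // /margin; ring.
Qed.

(** Choice probabilities are nonnegative, so [F] may be raised to the rewards; then the oracle
    replaces [S]. They vanish outside the assortment, so sums over all products are sums over it. *)
Lemma offer_best (j : 'I_m) (S : {set 'I_n}) (F : 'I_n -> R) :
  (forall i, F i <= (best P u v j i L).1) ->
  \sum_i phi P i j S * F i <= \sum_(i < n) demand P O u v i j * (best P u v j i L).1.
Proof.
move=> hF; have [h0 _ h2 _] := choiceP.
have in_S S' (G : 'I_n -> R) : \sum_(i < n) phi P i j S' * G i = \sum_(i in S') G i * phi P i j S'.
  rewrite [RHS]big_mkcond; apply: eq_bigr => i _.
  by case: ifP => [_|/negbT iS]; rewrite 1?mulrC // h2 ?mulr0.
apply: (@le_trans _ _ (\sum_(i in S) rewards P u v j i * phi P i j S)).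
  by rewrite in_S; apply: ler_sum => i _; rewrite ler_wpM2r // ffunE.
apply: le_trans (oracleP j (rewards P u v j) S) _.
rewrite le_eqVlt; apply/orP; left; apply/eqP.
have -> : O j (rewards P u v j) = offer P O u v j by rewrite /offer at_indexE.
rewrite -in_S; apply: eq_bigr => i _; by rewrite demandE ffunE.
Qed.

End Stage.

Lemma value_stock0 u i l : value P O u i l 0 = 0.
Proof. by case: u. Qed.

Lemma value_mono u i l x : value P O u i l x.-1 <= value P O u i l x.
Proof.
elim: u i l x => //= u IH i l x; apply: next_value_mono => //.
exact: value_stock0.
Qed.

(** At most [u] units can be sold in [u] periods. This justifies replacing the initial stock by
    [cap]. *)
Lemma value_saturated u i l x : (u <= x)%N -> value P O u i l x = value P O u i l u.
Proof.
elim: u x => //= u IH [|x] // ux; rewrite /next_value.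
by rewrite (IH x) // (IH x.+1) ?(IH u.+1) // ltnW.
Qed.

Section Policy.
Variable pi : policy R n m L.

(** [event_prob] with the period erased: taking arrivals from column 0 leaves a kernel that depends
    on the history alone, as [expect] requires. *)
Definition event_rate (h : history n m L) (e : event n m L) : R :=
  match e with
  | None => 1 - \sum_(j < m) arr P j 0
  | Some (j, d, Some i) => arr P j 0 * pi h j d * phi P i j d.1
  | Some (j, d, None) => arr P j 0 * pi h j d * (1 - \sum_i phi P i j d.1)
  end.

Definition total_profit (h : history n m L) : R := \sum_(e <- h) event_profit P e.

Lemma expected_profitE : expected_profit P pi = expect event_rate T [::] total_profit.
Proof.
rewrite -expect_tuple; apply: eq_bigr => w _; rewrite cat0s; congr (_ * _); last first.
  by rewrite /total_profit big_tuple.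
apply: eq_bigr => t _; rewrite cat0s /event_prob /event_rate.
have T0 : (0 < T)%N by apply: leq_trans (ltn_ord t).
case: (tnth w t) => [[[j d] [i|]]|]; rewrite ?(arr_stationary j t T0) //.
by congr (_ - _); apply: eq_bigr => j _; rewrite (arr_stationary j t T0).
Qed.

Hypothesis pi_prob : forall h j, (forall d, 0 <= pi h j d) /\ \sum_d pi h j d = 1.

(** No arrival and no purchase have the same effect, so their mass can be collected in [G None] and
    only sales contribute differences. *)
Lemma sum_event_rate h (G : event n m L -> R) : (forall j d, G (Some (j, d, None)) = G None) ->
  \sum_e event_rate h e * G e = G None +
    \sum_(j < m) arr P j 0 * \sum_d pi h j d * \sum_i phi P i j d.1 * (G (Some (j, d, Some i)) - G None).
Proof.
move=> hG; rewrite sum_option /= mulrBl mul1r -addrA; congr (_ + _).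
rewrite mulr_suml addrC.
rewrite !sum_pair -sumrB; apply: eq_bigr => j _.
have -> : arr P j 0 * G None = \sum_d arr P j 0 * pi h j d * G None.
  rewrite -mulr_suml -mulr_sumr; by have [_ ->] := pi_prob h j; rewrite mulr1.
rewrite -sumrB mulr_sumr; apply: eq_bigr => d _.
rewrite sum_option /= hG.
have -> : \sum_i phi P i j d.1 * (G (Some (j, d, Some i)) - G None) =
  \sum_i phi P i j d.1 * G (Some (j, d, Some i)) - (\sum_i phi P i j d.1) * G None.
  by rewrite mulr_suml -sumrB; apply: eq_bigr => i _; rewrite mulrBr.
rewrite [X in _ + X - _](_ : _ = arr P j 0 * pi h j d * \sum_i phi P i j d.1 * G (Some (j, d, Some i))).
  by ring.
by rewrite mulr_sumr; apply: eq_bigr => i _; rewrite mulrA.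
Qed.

Lemma event_rate_sum h : \sum_e event_rate h e = 1.
Proof.
under eq_bigr do rewrite -[event_rate _ _]mulr1.
rewrite (@sum_event_rate h (fun=> 1)) // big1 ?addr0 // => j _; rewrite big1 ?mulr0 // => d _.
by rewrite big1 ?mulr0 // => i _; rewrite subrr mulr0.
Qed.

Lemma event_rate_ge0 h e : 0 <= event_rate h e.
Proof.
have [c0 c1 _ _] := choiceP; case: e => [[[j d] [i|]]|] /=.
- by rewrite !mulr_ge0 ?arr_ge0 //; have [] := pi_prob h j.
- by rewrite !mulr_ge0 ?arr_ge0 ?subr_ge0 //; have [] := pi_prob h j.
- by rewrite subr_ge0 arr_sum.
Qed.

End Policy.
End Value.

(** * Comparison with an arbitrary feasible policy *)

Section Guarantee.
Variables (R : realType) (n m L T : nat) (P : problem R n m L T) (O : oracle R n m).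
Hypotheses (arrP : arrival_probabilities P) (choiceP : choice_model P).
Hypotheses (statP : stationary P) (oracleP : assortment_oracle P O).

Lemma plan_policy_prob (h : history n m L) (j : 'I_m) :
  (forall d, 0 <= plan_policy P O h j d) /\ \sum_d plan_policy P O h j d = 1.
Proof. by have [] := plan_policy_feasible P O h j. Qed.

Lemma stock_rcons (h : history n m L) e i l :
  stock P (rcons h e) i l = (stock P h i l - sells i l e)%N.
Proof. by rewrite /stock -cats1 count_cat /= addn0 subnDA. Qed.

Definition stock_value u (x : 'I_n -> 'I_L -> nat) : R :=
  \sum_(i < n) \sum_(l < L) value P O u i l (x i l).

Lemma stock_value_sale u x (y : 'I_n -> 'I_L -> nat) i l : (0 < x i l)%N ->
  (forall i' l', y i' l' = (x i' l' - ((i == i') && (l == l')))%N) ->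
  stock_value u y - stock_value u x = - (value P O u i l (x i l) - value P O u i l (x i l).-1).
Proof.
move=> x0 hy; rewrite /stock_value -sumrB (bigD1 i) //= -sumrB (bigD1 l) //=.
rewrite !big1 ?addr0; first by rewrite hy !eqxx subn1 opprB.
  by move=> i' ii; rewrite -sumrB big1 // => l' _; rewrite hy eq_sym (negPf ii) subn0 subrr.
by move=> l' ll; rewrite hy [l == _]eq_sym (negPf ll) andbF subn0 subrr.
Qed.

(** The Bellman equation of the plan. The value stays additive because a sale touches one stock only
    and a diverted sale touches none. *)
Lemma plan_step k (h : history n m L) : (size h + k.+1)%N = T ->
  \sum_e event_rate P (plan_policy P O) h e *
    (event_profit P e + stock_value k (stock P (rcons h e))) =
  stock_value k.+1 (stock P h).
Proof.
move=> hk; have kT : (k < T)%N by lia.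
have ek : (T - (size h).+1)%N = k by lia.
pose G e := event_profit P e + stock_value k (stock P (rcons h e)).
have G0 : G None = stock_value k (stock P h).
  rewrite /G /= add0r; apply: eq_bigr => i _; apply: eq_bigr => l _.
  by rewrite stock_rcons subn0.
rewrite (@sum_event_rate _ _ _ _ _ P _ plan_policy_prob h G); last first.
  move=> j d; rewrite G0 /G /= add0r; apply: eq_bigr => i _; apply: eq_bigr => l _.
  by rewrite stock_rcons subn0.
rewrite G0; pose x := stock P h; pose v := value P O k.
pose D (j : 'I_m) (i : 'I_n) : R := \sum_(l < L) (if served P k v j i l && (0 < x i l)%N
     then rew P i j l - (v i l (x i l) - v i l (x i l).-1) else 0).
transitivity (stock_value k x + \sum_(j < m) arr P j k * \sum_(i < n) demand P O k v i j * D j i).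
  congr (_ + _); apply: eq_bigr => j _; congr (_ * _).
    (* The kernel takes arrivals from column 0, the recursion from column [k]. *)
    have T0 : (0 < T)%N by lia.
    by rewrite (arr_stationary statP j (Ordinal kT)) // (arr_stationary statP j (Ordinal kT)).
  rewrite (bigD1 (plan P O k x j)) //= [X in _ + X]big1 ?addr0; last first.
    by move=> d dp; rewrite /plan_policy ek (negPf dp) mul0r.
  rewrite {1}/plan_policy ek eqxx mul1r; apply: eq_bigr => i _.
  rewrite demandE; congr (_ * _).
  have none (d : decision n L) : d.2 i = None -> G (Some (j, d, Some i)) - stock_value k (stock P h) = 0.
    move=> e; rewrite /G /= e add0r; apply/eqP; rewrite subr_eq0; apply/eqP.
    apply: eq_bigr => i' _; apply: eq_bigr => l _.
    by rewrite stock_rcons /= /sells; case: eqP => [<-|_]; rewrite ?e /= subn0.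
  have sold (d : decision n L) l : d.2 i = Some l -> (0 < x i l)%N ->
      G (Some (j, d, Some i)) - stock_value k (stock P h) =
      rew P i j l - (v i l (x i l) - v i l (x i l).-1).
    move=> e x0; rewrite /G /= e -addrA (@stock_value_sale _ _ _ i l) //.
      by rewrite /rew /= !at_indexE.
    move=> i' l'; rewrite stock_rcons /sells; case: (eqVneq i i') => [<-|//].
    by rewrite e.
  rewrite /D; case ef: (best P k v j i L).2 => [|l0].
    rewrite none ?big1 //=; first by move=> l _; rewrite /served ef.
    by rewrite ffunE -/v ef.
  have lL : (l0 < L)%N by rewrite -ef best_le.
  have s0 l : served P k v j i l = (l0 == l) by rewrite /served ef.
  rewrite (bigD1 (Ordinal lL)) //= s0 eqxx /= big1 ?addr0; last first.
    by move=> l; rewrite -val_eqE /= eq_sym s0 => /negPf->.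
  have e2 : (plan P O k x j).2 i = if (0 < x i (Ordinal lL))%N then Some (Ordinal lL) else None.
    by rewrite ffunE -/v ef insubT.
  case: ifP e2 => x0 e2; first by rewrite (sold _ _ e2).
  by rewrite none.
rewrite /stock_value -/x.
transitivity (\sum_(i < n) \sum_(l < L) (v i l (x i l) + \sum_(j < m)
   (if served P k v j i l && (0 < x i l)%N
     then rate P O k v j i * (rew P i j l - (v i l (x i l) - v i l (x i l).-1)) else 0))); last first.
  apply: eq_bigr => i _; apply: eq_bigr => l _ /=.
  by rewrite next_valueE // => ? ?; apply: value_stock0.
under [RHS]eq_bigr do rewrite big_split.
rewrite big_split /=; congr (_ + _).
transitivity (\sum_(j < m) \sum_(i < n) \sum_(l < L) (if served P k v j i l && (0 < x i l)%N
     then rate P O k v j i * (rew P i j l - (v i l (x i l) - v i l (x i l).-1)) else 0)).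
  apply: eq_bigr => j _; rewrite mulr_sumr; apply: eq_bigr => i _.
  rewrite mulrA mulr_sumr; apply: eq_bigr => l _; by case: ifP; rewrite ?mulr0.
rewrite exchange_big; apply: eq_bigr => i _; exact: exchange_big.
Qed.

Lemma plan_policy_value :
  expected_profit P (plan_policy P O) = stock_value T (stock0 P).
Proof.
rewrite (expected_profitE statP).
suff h k (h : history n m L) : (size h + k)%N = T ->
    expect (event_rate P (plan_policy P O)) k h (total_profit P) =
    total_profit P h + stock_value k (stock P h).
  rewrite (h T [::] (add0n T)) /total_profit big_nil add0r.
  by apply: eq_bigr => i _; apply: eq_bigr => l _; rewrite /stock subn0.
elim: k h => [|k IH] h hk /=.
  by rewrite [stock_value _ _]big1 ?addr0 // => i _; rewrite big1.
rewrite -(plan_step hk) -[total_profit P h]mul1r.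
rewrite -(event_rate_sum P plan_policy_prob h) mulr_suml -big_split.
apply: eq_bigr => e _; rewrite IH; last by rewrite size_rcons addSnnS.
rewrite /total_profit -cats1 big_cat big_seq1 /=; ring.
Qed.

Section Competitor.
Variable pi : policy R n m L.
Hypothesis pi_feas : feasible P pi.

Lemma feasible_prob (h : history n m L) (j : 'I_m) :
  (forall d, 0 <= pi h j d) /\ \sum_d pi h j d = 1.
Proof. by have [] := pi_feas h j. Qed.

(** A competitor may sell at a loss. Dropping the losses only favours it, and nonnegative gains are
    what allows each stock to have its own factor, at least the common ratio. *)
Definition gain (i : 'I_n) (l : 'I_L) (e : event n m L) : R :=
  (sells i l e)%:R * Num.max 0 (event_profit P e).

Definition total_gain i l : R :=
  expect (event_rate P pi) T [::] (fun h => \sum_(e <- h) gain i l e).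
Definition total_sales i l : R :=
  expect (event_rate P pi) T [::] (fun h => (count (sells i l) h)%:R).

Definition never_oversold (h : history n m L) := forall i l, (count (sells i l) h <= stock0 P i l)%N.

(** A sale of positive probability comes from a decision of positive probability and from an offered
    product, so feasibility guarantees a unit in stock. *)
Lemma never_oversold_rcons h e : never_oversold h -> 0 < event_rate P pi h e ->
  never_oversold (rcons h e).
Proof.
have [c0 _ c2 _] := choiceP.
move=> ih e0 i l; rewrite -cats1 count_cat /= addn0; case s: (sells i l e); last first.
  by rewrite addn0.
case: e e0 s => [[[j d] [i'|]]|] //= e0 /andP[/eqP ei /eqP di]; rewrite addn1.
subst i'.
have a0 : 0 <= arr P j 0 by apply: arr_ge0.
have [p0 _ feas] := pi_feas h j.
have pd : 0 < pi h j d.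
  rewrite lt_neqAle p0 andbT; apply/eqP => z; by move: e0; rewrite -z mulr0 mul0r ltxx.
have id : i \in d.1.
  by apply: contraT => /c2 z; move: e0; rewrite z mulr0 ltxx.
by have := feas d pd i l id di; rewrite subn_gt0.
Qed.

Let rate0 := event_rate_ge0 arrP choiceP feasible_prob.
Let rate1 := event_rate_sum P feasible_prob.

Lemma expect_oversold_le (F G : history n m L -> R) :
  (forall h, never_oversold h -> F h <= G h) ->
  expect (event_rate P pi) T [::] F <= expect (event_rate P pi) T [::] G.
Proof.
move=> le; apply: (@expect_le _ _ _ rate0 never_oversold) => // h e.
exact: never_oversold_rcons.
Qed.

Lemma total_sales_le i l : total_sales i l <= (cap P i l)%:R.
Proof.
rewrite /cap /= !at_indexE /minn; case: ifP => _.
  rewrite -[leRHS](expect_cst rate1 T [::]); apply: expect_oversold_le => h ih.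
  by rewrite ler_nat.
have <- : expect (event_rate P pi) T [::] (fun h => (size h)%:R) = T%:R.
  by rewrite (expect_size rate1).
by apply: expect_oversold_le => h _; rewrite ler_nat count_size.
Qed.

Lemma total_gain_ge0 i l : 0 <= total_gain i l.
Proof.
rewrite -[leLHS](expect_cst rate1 T [::] 0); apply: expect_oversold_le => h _.
by apply: sumr_ge0 => e _; rewrite mulr_ge0 // le_max lexx.
Qed.

Lemma total_gain_no_stock i l : stock0 P i l = 0%N -> total_gain i l = 0.
Proof.
move=> z; apply/eqP; rewrite eq_le total_gain_ge0 andbT.
rewrite -[leRHS](expect_cst rate1 T [::] 0); apply: expect_oversold_le => h ih.
have := ih i l; rewrite z leqNgt -has_count => /hasPn no.
by rewrite big_seq big1 // => e /no /negPf se; rewrite /gain se mul0r.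
Qed.

Lemma profit_le_gain : expected_profit P pi <= \sum_(i < n) \sum_(l < L) total_gain i l.
Proof.
rewrite (expected_profitE statP).
under [leRHS]eq_bigr do rewrite -expect_sum; rewrite -expect_sum.
apply: expect_oversold_le => h _.
under [leRHS]eq_bigr do rewrite exchange_big; rewrite exchange_big /=.
apply: ler_sum => e _.
have g0 i l : 0 <= gain i l e by rewrite mulr_ge0 // le_max lexx.
have s0 : 0 <= \sum_(i < n) \sum_(l < L) gain i l e by do 2!apply: sumr_ge0 => ? _.
case: e g0 s0 => [[[j d] [i|]]|] //= g0 s0.
case di: (d.2 i) => [l|] //.
rewrite (bigD1 i) //= (bigD1 l) //= -addrA.
rewrite {1}/gain /= di !eqxx /= mul1r.
apply: ler_wpDr; last by rewrite le_max lexx orbT.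
by apply: addr_ge0; apply: sumr_ge0 => *; rewrite ?sumr_ge0.
Qed.

(** Charge the competitor the prices of stage [u] and discount its gains by the availabilities.
    Whatever the history, one period then earns at most the stage gain, since the offer is best for
    exactly these rewards; this is summed over all T periods. *)
Lemma gain_le_stage u : (u < T)%N ->
  \sum_(i < n) \sum_(l < L) (total_gain i l * avail P u i l - total_sales i l * price P u (value P O u) i l) <=
  stage_gain P O u (value P O u) *+ T.
Proof.
move=> uT; set v := value P O u.
pose a (e : event n m L) : R :=
  \sum_(i < n) \sum_(l < L) (avail P u i l * gain i l e + (- price P u v i l) * (sells i l e)%:R).
have -> : \sum_(i < n) \sum_(l < L) (total_gain i l * avail P u i l - total_sales i l * price P u v i l) =
    expect (event_rate P pi) T [::] (fun h => \sum_(e <- h) a e).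
  transitivity (expect (event_rate P pi) T [::] (fun h => \sum_(i < n) \sum_(l < L)
     (avail P u i l * (\sum_(e <- h) gain i l e) + (- price P u v i l) * (count (sells i l) h)%:R))).
    rewrite expect_sum; apply: eq_bigr => i _; rewrite expect_sum; apply: eq_bigr => l _.
    rewrite expectD !expectZ /total_gain /total_sales; ring.
  apply: eq_expect => h; rewrite /a [RHS]exchange_big /=; apply: eq_bigr => i _.
  rewrite [RHS]exchange_big /=; apply: eq_bigr => l _.
  rewrite big_split /= -!mulr_sumr; congr (_ + _ * _).
  by rewrite -sumn_count sumnE big_map natr_sum.
have := @expect_additive_le _ _ _ rate0 rate1 a (stage_gain P O u v) T [::].
rewrite big_nil add0r; apply => h.
have v0 : forall i l, v i l 0%N = 0 by move=> *; exact: value_stock0.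
have vm : forall i l x, v i l x.-1 <= v i l x by move=> *; exact: value_mono.
have a0 : a None = 0.
  rewrite /a big1 // => i _; rewrite big1 // => l _.
  by rewrite /gain /= mulr0 mul0r mulr0 addr0.
rewrite (sum_event_rate P feasible_prob); last first.
  by move=> j d; rewrite a0 -a0; apply: eq_bigr => i _; apply: eq_bigr => l _; rewrite /gain /=.
rewrite a0 add0r; apply: ler_sum => j _.
have -> : arr P j 0 = arr P j u.
  have T0 : (0 < T)%N by lia.
  by rewrite (arr_stationary statP j (Ordinal uT)) // (arr_stationary statP j (Ordinal uT)).
apply: ler_wpM2l; first exact: arr_ge0.
have [p0 p1] := feasible_prob h j.
rewrite -[leRHS]mul1r -p1 mulr_suml; apply: ler_sum => d _; apply: ler_wpM2l => //.
apply: offer_best => // i; rewrite subr0.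
have aE l : d.2 i = Some l -> a (Some (j, d, Some i)) =
    avail P u i l * Num.max 0 (rew P i j l) - price P u v i l.
  move=> di; rewrite /a (bigD1 i) //= (bigD1 l) //= !big1 ?addr0.
  - by rewrite /gain /= di !eqxx mul1r mulr1 /rew /= !at_indexE.
  - move=> i' ii; rewrite big1 // => l' _.
    by rewrite /gain /= [i == _]eq_sym (negPf ii) /= mul0r !mulr0 addr0.
  - move=> l' ll; rewrite /gain /= di eqxx /= (_ : (Some l == Some l') = false) ?mul0r ?mulr0 ?addr0 //.
    by apply/eqP => -[e]; rewrite e eqxx in ll.
case di: (d.2 i) => [l|]; last first.
  rewrite /a big1 ?best_ge0 // => i' _; rewrite big1 // => l _.
  by rewrite /gain /= di andbF mul0r !mulr0 addr0.
rewrite (aE l di); have pr := price_ge0 P u vm i l.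
case: (leP 0 (rew P i j l)) => r0.
  by rewrite mulrC; apply: best_max.
(* A sale at a loss has gain 0 and pays the price, which is worse than the virtual warehouse. *)
by rewrite mulr0 add0r; apply: le_trans (best_ge0 _ _ _ _ _ _); rewrite oppr_le0.
Qed.

(** The value of the last [u] periods of the plan when the stock has followed the pretended drift in
    the [T - u] periods before. *)
Definition potential u : R :=
  \sum_(i < n) \sum_(l < L) smooth_value P (value P O u) i l (T - u) (cap P i l).

(** A pretended period, costing drift times price, is traded for a planned one, bringing the stage
    gain. After multiplication by T the drift becomes [cap], which is at least the competitor's
    sales. *)
Lemma potential_step u : (u < T)%N ->
  potential u + \sum_(i < n) \sum_(l < L) total_gain i l * (avail P u i l / T%:R) <= potential u.+1.
Proof.
move=> uT; set v := value P O u.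
have v0 : forall i l, v i l 0%N = 0 by move=> *; exact: value_stock0.
have vm : forall i l x, v i l x.-1 <= v i l x by move=> *; exact: value_mono.
have TR : 0 < T%:R :> R by rewrite ltr0n; lia.
have e1 : potential u.+1 = stage_gain P O u v +
    \sum_(i < n) \sum_(l < L) smooth_value P v i l (T - u.+1) (cap P i l).
  rewrite stage_gainE -big_split; apply: eq_bigr => i _; rewrite -big_split.
  apply: eq_bigr => l _; rewrite /smooth_value /= next_value_smooth //.
  by rewrite addrC.
have e2 : potential u = \sum_(i < n) \sum_(l < L) smooth_value P v i l (T - u.+1) (cap P i l) -
    \sum_(i < n) \sum_(l < L) drift P i l * price P u v i l.
  rewrite -sumrB; apply: eq_bigr => i _; rewrite -sumrB; apply: eq_bigr => l _.
  rewrite /smooth_value (_ : (T - u = (T - u.+1).+1)%N); last by lia.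
  exact: iter_smoothS.
rewrite e1 e2 [leRHS]addrC -addrA lerD2l addrC -sumrB.
rewrite -(ler_pM2r TR) [leRHS]mulr_natr; apply: le_trans (gain_le_stage uT).
rewrite mulr_suml; apply: ler_sum => i _; rewrite -sumrB mulr_suml; apply: ler_sum => l _.
have -> : (total_gain i l * (avail P u i l / T%:R) - drift P i l * price P u v i l) * T%:R =
    total_gain i l * avail P u i l - (cap P i l)%:R * price P u v i l.
  by rewrite /drift; field; rewrite gt_eqF.
rewrite lerD2l lerN2 -/v ler_wpM2r //; last exact: total_sales_le.
exact: price_ge0.
Qed.

Lemma potential0 : potential 0 = 0.
Proof.
rewrite /potential big1 // => i _; rewrite big1 // => l _; rewrite /smooth_value /=.
elim: (T - 0)%N (cap P i l) => // s IH x; by rewrite /= /smooth !IH !mulr0 addr0.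
Qed.

Lemma potential_sum u : (u <= T)%N ->
  \sum_(i < n) \sum_(l < L) total_gain i l * ((\sum_(0 <= w < u) avail P w i l) / T%:R) <= potential u.
Proof.
elim: u => [|u IH] uT.
  rewrite potential0 big1 // => i _; rewrite big1 // => l _.
  by rewrite big_geq // mul0r mulr0.
apply: le_trans (potential_step uT).
have -> : \sum_(i < n) \sum_(l < L) total_gain i l * ((\sum_(0 <= w < u.+1) avail P w i l) / T%:R) =
  \sum_(i < n) \sum_(l < L) total_gain i l * ((\sum_(0 <= w < u) avail P w i l) / T%:R) +
  \sum_(i < n) \sum_(l < L) total_gain i l * (avail P u i l / T%:R).
  rewrite -big_split; apply: eq_bigr => i _; rewrite -big_split; apply: eq_bigr => l _.
  by rewrite big_nat_recr //= mulrDl mulrDr.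
by rewrite lerD2r IH // ltnW.
Qed.

Lemma potentialT : potential T = expected_profit P (plan_policy P O).
Proof.
rewrite plan_policy_value; apply: eq_bigr => i _; apply: eq_bigr => l _.
rewrite /smooth_value subnn /= /cap /= !at_indexE.
case: (leqP (stock0 P i l) T) => h //.
by rewrite (value_saturated _ _ _ _ (ltnW h)).
Qed.

(** Drift times availability is the expected number of units leaving in one pretended period, so the
    sum telescopes to the stock sold. *)
Lemma sum_avail i l : (0 < cap P i l)%N ->
  (\sum_(0 <= u < T) avail P u i l) / T%:R = 1 - left_stock P i l T (cap P i l) / (cap P i l)%:R.
Proof.
move=> c0; have T0 : (0 < T)%N by apply: leq_trans c0 (geq_minr _ _).
have tele s : drift P i l * \sum_(0 <= w < s) (left_stock P i l w (cap P i l) - left_stock P i l w (cap P i l).-1) =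
    (cap P i l)%:R - left_stock P i l s (cap P i l).
  elim: s => [|s IH]; first by rewrite big_geq // mulr0 subrr.
  rewrite big_nat_recr // mulrDr IH /left_stock iter_smoothS; ring.
have -> : \sum_(0 <= u < T) avail P u i l =
  \sum_(0 <= w < T) (left_stock P i l w (cap P i l) - left_stock P i l w (cap P i l).-1).
  by rewrite [RHS]big_nat_rev; apply: eq_bigr => u _; rewrite add0n.
have := tele T; rewrite /drift; set A := \sum_(0 <= w < T) _; move: (left_stock _ _ _ _ _) => B e.
have cR : (cap P i l)%:R != 0 :> R by rewrite pnatr_eq0 -lt0n.
have TR : T%:R != 0 :> R by rewrite pnatr_eq0 -lt0n.
apply: (mulfI cR); rewrite mulrBr mulr1 [RHS](_ : _ = (cap P i l)%:R - B).
  by rewrite -e; field.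
by field.
Qed.

End Competitor.

Lemma cmin_le i l : (0 < stock0 P i l)%N -> (0 < cmin P)%N /\ (cmin P <= stock0 P i l)%N.
Proof.
move=> s0; rewrite /cmin; split.
  elim/big_rec: _ => [|p x ? ?]; last by rewrite leq_min; apply/andP.
  by apply: leq_trans s0 (leq_bigmax (i, l)).
move: (\max_(p : 'I_n * 'I_L) _)%N => d.
have : (i, l) \in index_enum ('I_n * 'I_L)%type by rewrite mem_index_enum.
elim: (index_enum _) => //= p r IH; rewrite inE big_cons => /orP[/eqP<- /=|/IH h].
  by rewrite s0 geq_minl.
case: ifP => _; [exact: leq_trans (geq_minr _ _) h|exact: h].
Qed.

Theorem plan_policy_guarantee :
  Num.max (1 - (expR 1)^-1) (1 - (Num.sqrt (cmin P)%:R)^-1) * J1_star P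
    <= expected_profit P (plan_policy P O).
Proof.
set rho := Num.max _ _.
have rho0 : 0 < rho.
  rewrite lt_max subr_gt0 invf_lt1 ?expR_gt0 //; apply/orP; left.
  by apply: lt_le_trans (expR_ge1Dx 1); lra.
suff dom pi : feasible P pi -> rho * expected_profit P pi <= expected_profit P (plan_policy P O).
  (* Dividing by the positive ratio turns the claim into an upper bound on the supremum; the plan
     itself shows that the set is nonempty. *)
  rewrite mulrC -ler_pdivlMr //; apply: ge_sup.
    by exists (expected_profit P (plan_policy P O)), (plan_policy P O) => //; apply: plan_policy_feasible.
  by move=> _ [pi /dom h ->]; rewrite ler_pdivlMr // mulrC.
move=> feas; case: (posnP T) => T0.
  have z pi' : expected_profit P pi' = 0.
    rewrite /expected_profit big1 // => w _; rewrite [X in _ * X]big1 ?mulr0 // => t.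
    by have := ltn_ord t; rewrite [X in (_ < X)%N]T0.
  by rewrite !z mulr0.
apply: le_trans (_ : rho * (\sum_(i < n) \sum_(l < L) total_gain pi i l) <= _).
  by rewrite ler_wpM2l ?(ltW rho0) //; exact: profit_le_gain.
rewrite -potentialT; apply: le_trans (potential_sum feas (leqnn T)).
rewrite mulr_sumr; apply: ler_sum => i _; rewrite mulr_sumr; apply: ler_sum => l _.
case: (posnP (stock0 P i l)) => s0.
  by rewrite (total_gain_no_stock feas s0) mulr0 mul0r.
rewrite mulrC ler_wpM2l //; first exact: total_gain_ge0.
have capE : cap P i l = minn (stock0 P i l) T by rewrite /cap /= !at_indexE.
have c0 : (0 < cap P i l)%N by rewrite capE leq_min s0.
have cT : (cap P i l <= T)%N by rewrite capE geq_minr.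
rewrite sum_avail //; have [f1 f2] := fill_rate R c0 cT.
rewrite ge_max f1 /=; have [m0 ms] := cmin_le s0.
case: (leqP (stock0 P i l) T) => h.
  apply: le_trans f2; rewrite lerD2l lerN2 lef_pV2 ?posrE ?sqrtr_gt0 ?ltr0n //.
  by rewrite ler_sqrt ?ltr0n // ler_nat capE (minn_idPl h).
(* With more than T units, [cmin] may exceed [cap], so the bound in terms of sqrt [cap] does not
   suffice. But the drift is then 1, the pretended demand surely uses up [cap], and the factor is
   1. *)
have -> : left_stock P i l T (cap P i l) = 0.
  have e : drift P i l = 1 by rewrite /drift capE (minn_idPr (ltnW h)) divff // pnatr_eq0 -lt0n.
  have e2 s x : (x <= s)%N -> left_stock P i l s x = 0.
    rewrite /left_stock e; elim: s x => [|s IH] x; first by rewrite leqn0 => /eqP->.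
    by move=> xs; rewrite iter_smoothS mul1r opprB addrC subrK IH //; lia.
  exact: e2.
by rewrite mul0r subr0 gerDl oppr_le0 invr_ge0 sqrtr_ge0.
Qed.

End Guarantee.

(** * Bit lengths *)

Section Bits.
Variable R : realType.
Implicit Types (u w : R) (b d : nat).

(** A possibly unreduced denominator. Together with a bound on the absolute value it composes under
    sums and products, and [has_bits_integral] returns to reduced fractions. *)
Definition integral d u : bool := u * d%:R \is a Num.int.

Lemma integralD d u w : integral d u -> integral d w -> integral d (u + w).
Proof. by rewrite /integral mulrDl; apply: rpredD. Qed.

Lemma integralB d u w : integral d u -> integral d w -> integral d (u - w).
Proof. by rewrite /integral mulrBl; apply: rpredB. Qed.

Lemma integralM d e u w : integral d u -> integral e w -> integral (d * e) (u * w).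
Proof. by rewrite /integral natrM mulrACA; apply: rpredM. Qed.

Lemma integral_muln d e u : integral d u -> integral (d * e) u.
Proof.
rewrite -[u]mulr1 => h; apply: integralM; first by rewrite -[u]mulr1.
by rewrite /integral mul1r; apply: natr_int.
Qed.

Lemma integral_mulnr d e u : integral d u -> integral (e * d) u.
Proof. by rewrite mulnC; apply: integral_muln. Qed.

Lemma integral0 d : integral d 0. Proof. by rewrite /integral mul0r. Qed.

(** By coprimality the reduced denominator divides [d], so reduction makes neither part larger. *)
Lemma has_bits_frac b d (z : int) : (0 < d < 2 ^ b)%N -> (`|z| < 2 ^ b)%N ->
  has_bits b (z%:~R / d%:R : R).
Proof.
move=> /andP[d0 db] zb; pose q : rat := z%:~R / d%:R; exists q.
  by rewrite fmorph_div /= ratr_int ratr_nat.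
have e : (`|numq q| * d = `|z| * `|denq q|)%N.
  rewrite -[d]/(`|d%:Z|%N) -!abszM; congr (absz _).
  apply: (@intr_inj rat); rewrite !rmorphM /= numqE mulrAC divfK //.
  by rewrite pnatr_eq0 -lt0n.
have cop := coprime_num_den q; have den0 : (0 < `|denq q|)%N by rewrite absz_gt0 denq_neq0.
have dd : (`|denq q| %| d)%N.
  by rewrite -(@Gauss_dvdr _ `|numq q|) 1?coprime_sym // e dvdn_mull.
apply/andP; split; last by apply: leq_ltn_trans (dvdn_leq d0 dd) db.
apply: leq_ltn_trans zb; rewrite -(leq_pmul2r den0) -e leq_mul2l.
by rewrite (dvdn_leq d0 dd) orbT.
Qed.

Lemma has_bits_integral b d M u : integral d u -> (0 < d)%N -> `|u| <= M%:R ->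
  (d < 2 ^ b)%N -> (M * d < 2 ^ b)%N -> has_bits b u.
Proof.
move=> /intrP[z e] d0 uM db Mb.
have dR : 0 < d%:R :> R by rewrite ltr0n.
have -> : u = z%:~R / d%:R by rewrite -e mulfK // gt_eqF.
apply: has_bits_frac; first by rewrite d0.
apply: leq_ltn_trans Mb; rewrite -(ler_nat R) natrM.
apply: le_trans (ler_wpM2r (ltW dR) uM).
have -> : `|u| * d%:R = `|z%:~R| by rewrite -e normrM (ger0_norm (ltW dR)).
by rewrite -intr_norm -natr_absz.
Qed.

Lemma has_bitsP b u : has_bits b u ->
  exists d, [/\ (0 < d < 2 ^ b)%N, integral d u & `|u| <= (2 ^ b)%:R].
Proof.
move=> [q -> /andP[nb db]]; exists `|denq q|%N.
have d0 : (0 < `|denq q|)%N by rewrite absz_gt0 denq_neq0.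
have e : ratr q * (`|denq q|%N)%:R = (numq q)%:~R :> R.
  rewrite [ratr q]/(_ / _) natr_absz gtr0_norm ?denq_gt0 // divfK //.
  by rewrite intr_eq0 denq_neq0.
split; [by rewrite d0|by rewrite /integral e; apply: intr_int|].
have dR : 1 <= (`|denq q|%N)%:R :> R by rewrite ler1n.
apply: le_trans (_ : `|ratr q| * (`|denq q|%N)%:R <= _).
  by rewrite ler_peMr.
rewrite -[(_ %:R)]ger0_norm ?ler0n // -normrM e -intr_norm -natr_absz ler_nat.
exact: ltnW.
Qed.

Lemma has_bits_le b b' u : (b <= b')%N -> has_bits b u -> has_bits b' u.
Proof.
move=> bb [q e /andP[h1 h2]]; have l : (2 ^ b <= 2 ^ b')%N by rewrite leq_exp2l.
by exists q; rewrite // (leq_trans h1 l) (leq_trans h2 l).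
Qed.

(** The product of the denominators and the absolute value of the result are each at most 2^(2b), so
    5b bits leave room. Division is left out: the only quotient formed by the program is [drift],
    bounded directly. *)
Lemma has_bits_op b o u w : (0 < b)%N -> has_bits b u -> has_bits b w ->
  if o is RDiv then True else has_bits (5 * b) (real_op o u w).
Proof.
move=> b0 /has_bitsP[d [/andP[d0 db] iu ub]] /has_bitsP[e [/andP[e0 eb] iw wb]].
have de0 : (0 < d * e)%N by rewrite muln_gt0 d0.
have p2 : (2 <= 2 ^ b)%N by rewrite -{1}(expn1 2) leq_exp2l.
have E : (2 ^ (5 * b) = 2 ^ b * 2 ^ b * (2 ^ b * 2 ^ b) * 2 ^ b)%N.
  by rewrite mulnC expnM !(expnS (2 ^ b)) expn0 muln1 !mulnA.
have de : (d * e < 2 ^ b * 2 ^ b)%N by nia.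
have w0 : (0 < 2 ^ b * 2 ^ b)%N by rewrite muln_gt0 !expn_gt0.
have W : (2 ^ b * 2 ^ b * (2 ^ b * 2 ^ b) <= 2 ^ (5 * b))%N by rewrite E leq_pmulr // ltnW.
have big2 : ((2 ^ b * 2 ^ b) * (d * e) < 2 ^ (5 * b))%N.
  by apply: leq_trans W; rewrite ltn_pmul2l.
have big1 : (d * e < 2 ^ (5 * b))%N.
  by apply: leq_ltn_trans big2; rewrite leq_pmull.
have sum (u' w' : R) : `|u'| <= (2 ^ b)%:R -> `|w'| <= (2 ^ b)%:R ->
    `|u' + w'| <= (2 ^ b * 2 ^ b)%:R.
  move=> h1 h2; apply: le_trans (ler_normD _ _) (le_trans (lerD h1 h2) _).
  by rewrite -natrD ler_nat; nia.
case: o => //=.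
- apply: (has_bits_integral (integralD (integral_muln e iu) (integral_mulnr d iw)) de0 _ big1 big2).
  exact: sum.
- apply: (has_bits_integral (integralB (integral_muln e iu) (integral_mulnr d iw)) de0 _ big1 big2).
  by apply: sum; rewrite ?normrN.
- apply: (has_bits_integral (integralM iu iw) de0 _ big1 big2).
  by rewrite normrM natrM ler_pM.
Qed.

Lemma has_bits_nat b k : (0 < b)%N -> (k < 2 ^ b)%N -> has_bits b (k%:R : R).
Proof.
move=> b0 kb; apply: (@has_bits_integral _ 1 k) => //.
- by rewrite /integral mulr1 natr_int.
- by rewrite ger0_norm.
- by rewrite -{1}(expn0 2) ltn_exp2l.
- by rewrite muln1.
Qed.

End Bits.

(** * Sizes of the quantities in the recursion *)

Section DataBits.
Variables (R : realType) (n m L T : nat) (P : problem R n m L T) (O : oracle R n m).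
Hypotheses (arrP : arrival_probabilities P) (choiceP : choice_model P).
Hypothesis T0 : (0 < T)%N.
Variable B : nat.
Hypothesis dataB : data_bits P B.

Definition small (u : R) : Prop :=
  exists d, [/\ (0 < d)%N, (d <= 2 ^ B)%N, integral d u & `|u| <= (2 ^ B)%:R].

Lemma small0 : small 0.
Proof. by exists 1%N; split; rewrite ?expn_gt0 ?integral0 ?normr0 ?ler0n. Qed.

Lemma small_has_bits u : has_bits B u -> small u.
Proof. by move=> /has_bitsP[d [/andP[d0 db] iu ub]]; exists d; split=> //; exact: ltnW. Qed.

Lemma small_arr j u : small (arr P j u).
Proof.
have [h _ _ _] := dataB; rewrite /arr /=.
apply: (at_index_ind (Q := small)) => [|j']; first exact: small0.
apply: (at_index_ind (Q := small)) => [|t]; [exact: small0|exact: small_has_bits].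
Qed.

Lemma small_rew i j l : small (rew P i j l).
Proof.
have [_ _ h _] := dataB; rewrite /rew /=.
apply: (at_index_ind (Q := small)) => [|i']; first exact: small0.
apply: (at_index_ind (Q := small)) => [|j']; first exact: small0.
apply: (at_index_ind (Q := small)) => [|t]; [exact: small0|exact: small_has_bits].
Qed.

Lemma small_demand u v i j : small (demand P O u v i j).
Proof.
have [_ h _ _] := dataB; rewrite /demand.
apply: (at_index_ind (Q := small)) => [|i']; first exact: small0.
apply: (at_index_ind (Q := small)) => [|j']; [exact: small0|exact: small_has_bits].
Qed.

Lemma rate_le1 u v j i : rate P O u v j i <= 1.
Proof.
have a1 : arr P j u <= 1.
  have [h1 h2] := arrP; rewrite /arr /=.
  apply: (at_index_ind (Q := fun x => x <= 1)) => // j'.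
  apply: (at_index_ind (Q := fun x => x <= 1)) => // t.
  by apply: le_trans (h2 t); rewrite (bigD1 j') //= lerDl sumr_ge0.
by apply: mulr_ile1 => //; [exact: arr_ge0|exact: demand_ge0|exact: demand_le1].
Qed.

(** Each type contributes three data, its arrival rate, a choice probability and a profit, hence a
    factor of at most 2^(3B); one denominator serves both rates. *)
Lemma sale_gain_den u v i l k : exists d, [/\ (0 < d)%N, (d <= 2 ^ (3 * B * k))%N,
  integral d (sale_rate P O u v k i l) & integral d (gain_rate P O u v k i l)].
Proof.
elim: k => [|k [d [d0 db sd gd]]].
  exists 1%N; rewrite muln0 expn0; split=> //; by rewrite /sale_rate /gain_rate big_geq // integral0.
have [a [a0 ab ia _]] := small_arr k u; have [c [c0 cb ic _]] := small_demand u v i k.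
have [r [r0 rb ir _]] := small_rew i k l.
exists (d * (a * c * r))%N; split.
- by rewrite !muln_gt0 d0 a0 c0 r0.
- have e : (2 ^ (3 * B) = 2 ^ B * 2 ^ B * 2 ^ B)%N by rewrite -!expnD; congr (2 ^ _)%N; lia.
  by rewrite mulnSr expnD leq_mul // e !leq_mul.
- rewrite /sale_rate big_nat_recr //=; apply: integralD; first exact: integral_muln.
  apply: integral_mulnr; apply: integral_muln; case: ifP => _; last exact: integral0.
  exact: integralM.
- rewrite /gain_rate big_nat_recr //=; apply: integralD; first exact: integral_muln.
  apply: integral_mulnr; case: ifP => _; last exact: integral0.
  by apply: integralM => //; exact: integralM.
Qed.

Lemma sale_gain_le u v i l k : `|sale_rate P O u v k i l| <= k%:R /\
  `|gain_rate P O u v k i l| <= (k * 2 ^ B)%:R.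
Proof.
have r0 j : 0 <= rate P O u v j i by exact: rate_ge0.
elim: k => [|k [h1 h2]].
  by rewrite /sale_rate /gain_rate !big_geq // normr0.
rewrite /sale_rate /gain_rate !big_nat_recr //= mulSnr natrD -natr1.
split; apply: le_trans (ler_normD _ _) _; apply: lerD => //; case: ifP => _; rewrite ?normr0 //.
  by rewrite ger0_norm // rate_le1.
have [_ [_ _ _ rb]] := small_rew i k l.
rewrite normrM ger0_norm //; apply: le_trans rb; apply: ler_piMl => //; exact: rate_le1.
Qed.

(** The denominator is common to all stocks [x]. Values at [x] and [x.-1] can then be subtracted for
    free, and a period multiplies the denominator once instead of squaring it. *)
Lemma value_den u i l : exists d, [/\ (0 < d)%N, (d <= 2 ^ (3 * B * m * u))%N &
  forall x, integral d (value P O u i l x)].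
Proof.
elim: u => [|u [d [d0 db id]]].
  by exists 1%N; rewrite muln0 expn0; split=> // x; exact: integral0.
have [e [e0 eb sd gd]] := sale_gain_den u (value P O u) i l m.
exists (d * e)%N; split; first by rewrite muln_gt0 d0.
  by rewrite mulnSr expnD leq_mul.
case=> [|x] /=; first exact: integral0.
apply: integralD; first exact: integral_muln.
apply: integralB; first exact: integral_mulnr.
by rewrite mulnC; apply: integralM => //; apply: integralB.
Qed.

Lemma value_ge0 u i l x : 0 <= value P O u i l x.
Proof.
elim: x => [|x IH]; first by rewrite value_stock0.
by apply: le_trans IH _; exact: (value_mono O arrP choiceP u i l x.+1).
Qed.

Lemma value_le u i l x : value P O u i l x <= (u * (m * 2 ^ B))%:R.
Proof.
elim: u x => [|u IH] x //=; case: x => [|x] /=; first exact: ler0n.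
rewrite mulSnr natrD lerD // lerBlDr; apply: le_trans (_ : (m * 2 ^ B)%:R <= _).
  by have [_] := sale_gain_le u (value P O u) i l m; apply: le_trans; exact: ler_norm.
rewrite lerDl mulr_ge0 //.
  have := sale_rate01 O arrP choiceP u (value P O u) i l; by case/andP.
by rewrite subr_ge0; exact: (value_mono O arrP choiceP u i l x.+1).
Qed.

Lemma integral_smooth c d (g : nat -> R) s x : (c <= T)%N -> (forall x, integral d (g x)) ->
  integral (d * T ^ s) (iter s (smooth (c%:R / T%:R)) g x).
Proof.
move=> cT ig; have TR : T%:R != 0 :> R by rewrite pnatr_eq0 -lt0n.
elim: s x => [|s IH] x; first by rewrite expn0 muln1.
have -> : iter s.+1 (smooth (c%:R / T%:R)) g x =
    (T - c)%:R / T%:R * iter s (smooth (c%:R / T%:R)) g x +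
    c%:R / T%:R * iter s (smooth (c%:R / T%:R)) g x.-1.
  by rewrite [(T - c)%:R / _](_ : _ = 1 - c%:R / T%:R) // natrB // mulrBl divff.
have frac k : integral T (k%:R / T%:R : R) by rewrite /integral divfK // natr_int.
by rewrite expnS mulnCA; apply: integralD; apply: integralM.
Qed.

(** The first three summands bound a common denominator: values, T^T from smoothing, and data. The
    next three bound the absolute values, at most T m 2^B, and the 1 makes the inequality strict. *)
Definition width := (3 * B * m * T + T * T + B + T + m + B + 1)%N.

Lemma width_ok d M (u : R) : (0 < d)%N -> (d <= 2 ^ (3 * B * m * T + T * T + B))%N ->
  (M <= 2 ^ (T + m + B))%N -> integral d u -> `|u| <= M%:R -> has_bits width u.
Proof.
move=> d0 db Mb iu uM.
have w : (2 ^ width = 2 ^ (3 * B * m * T + T * T + B) * 2 ^ (T + m + B) * 2)%N.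
  by rewrite -expnD -expnSr; congr (2 ^ _)%N; rewrite /width; lia.
have p1 : (0 < 2 ^ (3 * B * m * T + T * T + B))%N by rewrite expn_gt0.
have p2 : (0 < 2 ^ (T + m + B))%N by rewrite expn_gt0.
apply: has_bits_integral iu d0 uM _ _; rewrite w; move: (2 ^ _)%N (2 ^ _)%N p1 p2 db Mb => X Y.
  by nia.
move=> X0 Y0 dX MY; apply: leq_ltn_trans (leq_mul MY dX) _.
have : (0 < X * Y)%N by rewrite muln_gt0 X0 Y0.
by rewrite (mulnC Y X); lia.
Qed.

Lemma width_gt0 : (0 < width)%N. Proof. by rewrite /width addn1. Qed.

Lemma width_small (u : R) : small u -> has_bits width u.
Proof.
move=> [d [d0 db iu ub]]; apply: (width_ok d0 _ _ iu ub).
  by apply: leq_trans db _; rewrite leq_exp2l // leq_addl.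
by rewrite leq_exp2l // leq_addl.
Qed.

Lemma width_nat k : (k <= T.+1)%N -> has_bits width (k%:R : R).
Proof.
move=> kT; apply: has_bits_nat width_gt0 _; apply: leq_ltn_trans kT _.
by apply: leq_trans (ltn_expl _ (isT : 1 < 2)%N) _; rewrite leq_exp2l // /width; lia.
Qed.

Lemma width_drift i l : has_bits width (drift P i l).
Proof.
have /andP[p0 p1] := drift01 P i l.
apply: (@width_ok T 1) => //.
- by apply: leq_trans (ltnW (ltn_expl _ (isT : 1 < 2)%N)) _; rewrite leq_exp2l //; nia.
- by rewrite expn_gt0.
- by rewrite /integral /drift divfK ?natr_int // pnatr_eq0 -lt0n.
- by rewrite ger0_norm.
Qed.

Lemma pow_le s : (s <= T)%N -> (T ^ s <= 2 ^ (T * T))%N.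
Proof.
move=> sT; apply: leq_trans (_ : (T ^ T <= _)%N); first by rewrite leq_pexp2l.
by rewrite expnM leq_exp2r // ltnW // ltn_expl.
Qed.

Lemma width_left i l s x : (s <= T)%N -> (x <= T)%N -> has_bits width (left_stock P i l s x).
Proof.
move=> sT xT; have i1 y : integral 1 (y%:R : R) by rewrite /integral mulr1 natr_int.
have := @integral_smooth (cap P i l) 1 (fun x => x%:R) s x (geq_minr _ _) i1.
rewrite mul1n => id; apply: (@width_ok _ T _ _ _ _ id).
- by rewrite expn_gt0 T0.
- by apply: leq_trans (pow_le sT) _; rewrite leq_exp2l //; lia.
- by apply: leq_trans (ltnW (ltn_expl _ (isT : 1 < 2)%N)) _; rewrite leq_exp2l //; lia.
- rewrite ger0_norm; last by apply: iter_smooth_ge0 (drift01 P i l) _ => y; rewrite ler0n.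
  by apply: le_trans (iter_smooth_le_nat s x (drift01 P i l)) _; rewrite ler_nat.
Qed.

Lemma width_value u i l s x : (u <= T)%N -> (s <= T)%N ->
  has_bits width (smooth_value P (value P O u) i l s x).
Proof.
move=> uT sT; have [d [d0 db id]] := value_den u i l.
have := @integral_smooth (cap P i l) d (value P O u i l) s x (geq_minr _ _) id.
move=> ids; apply: (@width_ok _ (u * (m * 2 ^ B)) _ _ _ _ ids).
- by rewrite muln_gt0 d0 expn_gt0 T0.
- apply: leq_trans (leq_mul db (pow_le sT)) _; rewrite -expnD leq_exp2l //.
  by apply: leq_trans (leq_addr _ _); rewrite leq_add2r leq_mul2l uT orbT.
- rewrite !expnD mulnA leq_mul2r; apply/orP; right; apply: leq_mul.
    by apply: leq_trans uT (ltnW (ltn_expl _ _)).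
  by rewrite ltnW // ltn_expl.
- rewrite ger0_norm; last by apply: iter_smooth_ge0 (drift01 P i l) _ => y; exact: value_ge0.
  by apply: iter_smooth_le (drift01 P i l) _ => y; exact: value_le.
Qed.

Lemma width_sale_gain u v i l k : (k <= m)%N ->
  has_bits width (sale_rate P O u v k i l) /\ has_bits width (gain_rate P O u v k i l).
Proof.
move=> km; have [d [d0 db sd gd]] := sale_gain_den u v i l k.
have [bs bg] := sale_gain_le u v i l k.
have dw : (d <= 2 ^ (3 * B * m * T + T * T + B))%N.
  apply: leq_trans db _; rewrite leq_exp2l // -addnA; apply: leq_trans (leq_addr _ _).
  by apply: leq_trans (leq_pmulr _ T0); rewrite leq_mul2l km orbT.
have km2 : (k <= 2 ^ m)%N by apply: leq_trans km (ltnW (ltn_expl _ _)).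
split; [apply: (width_ok d0 dw _ sd bs)|apply: (width_ok d0 dw _ gd bg)].
  by apply: leq_trans km2 _; rewrite leq_exp2l //; lia.
rewrite !expnD; apply: leq_mul => //; apply: leq_trans km2 _.
by rewrite leq_pmull // expn_gt0.
Qed.

Lemma width_le : (width <= 6 * (n + m + L + T + B).+1 ^ 3)%N.
Proof.
rewrite /width; set N := (n + m + L + T + B).+1.
have [hm hT hB h1] : [/\ m <= N, T <= N, B <= N & 1 <= N]%N by rewrite /N; split; lia.
have -> : (N ^ 3 = N * N * N)%N by rewrite !expnS expn0 muln1 mulnA.
have h2 : (N <= N * N)%N by rewrite leq_pmulr.
have h3 : (N * N <= N * N * N)%N by rewrite leq_pmulr.
have h4 : (T * T <= N * N)%N by exact: leq_mul.
have h5 : (B * m * T <= N * N * N)%N by rewrite !leq_mul.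
have h6 : (T + m + B + 1 <= N)%N by rewrite /N; lia.
have h7 : (3 * B * m * T = 3 * (B * m * T))%N by rewrite !mulnA.
by rewrite h7; move: (N * N * N)%N (N * N)%N (B * m * T)%N (T * T)%N h2 h3 h4 h5 h6; lia.
Qed.

End DataBits.

(** * The program *)

(** Scalars: 20/21 = u, u+1; 22/23 = i, i+1; 24/25 = l, l+1; 26/27 = s, s+1;
    28/29 = x, x+1; 30/31 = j, j+1; 32 = T-(u+1); 33/34 = cap, cap-1.
    Real arrays: 2 value, 3 drift, 4 left_stock, 5 smooth_value, 6 best (reward),
    7 margin, 8 rewards (for the oracle), 9 demand, 10 sale_rate, 11 gain_rate,
    12 avail, 13 price, 14 rate.
    Natural-number arrays: 40 offer (from the oracle), 41 its copy, 42 best (warehouse). *)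
Definition smooth_exp (a b : operand) : rexp :=
  Bin RAdd (Bin RMul (Bin RSub (Const 1) (Cell (3, [:: 22; 24]))) (Cell a))
           (Bin RMul (Cell (3, [:: 22; 24])) (Cell b)).

Definition smooth_prog : cmd :=
  Seq (For 28 29 3
         (Seq (Assign (4, [:: 22; 24; 12; 29]) (OfNat (sc 29)))
              (Assign (5, [:: 20; 22; 24; 12; 29]) (Cell (2, [:: 20; 22; 24; 29])))))
      (For 26 27 3 (For 28 29 3
         (Seq (Assign (4, [:: 22; 24; 27; 29])
                 (smooth_exp (4, [:: 22; 24; 26; 29]) (4, [:: 22; 24; 26; 28])))
              (Assign (5, [:: 20; 22; 24; 27; 29])
                 (smooth_exp (5, [:: 20; 22; 24; 26; 29]) (5, [:: 20; 22; 24; 26; 28])))))).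

Definition price_prog : cmd :=
  For 22 23 0 (For 24 25 2
    (Seq (IfNat (6, [:: 22; 24]) (sc 3)
            (NOp NAdd (sc 33) (6, [:: 22; 24]) (sc 12)) (NOp NAdd (sc 33) (sc 3) (sc 12)))
    (Seq (NOp NSub (sc 34) (sc 33) (sc 11))
    (Seq (Assign (3, [:: 22; 24]) (Bin RDiv (OfNat (sc 33)) (OfNat (sc 3))))
    (Seq smooth_prog
    (Seq (Assign (12, [:: 20; 22; 24])
            (Bin RSub (Cell (4, [:: 22; 24; 32; 33])) (Cell (4, [:: 22; 24; 32; 34]))))
         (Assign (13, [:: 20; 22; 24])
            (Bin RSub (Cell (5, [:: 20; 22; 24; 32; 33])) (Cell (5, [:: 20; 22; 24; 32; 34])))))))))).

Definition best_prog : cmd :=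
  For 22 23 0
    (Seq (For 24 25 2
      (Seq (Assign (7, [:: 20; 30; 22; 24])
              (Bin RSub (Bin RMul (Cell (1, [:: 22; 30; 24])) (Cell (12, [:: 20; 22; 24])))
                        (Cell (13, [:: 20; 22; 24]))))
           (IfReal (7, [:: 20; 30; 22; 24]) (6, [:: 20; 30; 22; 24])
              (Seq (Assign (6, [:: 20; 30; 22; 25]) (Cell (6, [:: 20; 30; 22; 24])))
                   (NOp NAdd (42, [:: 20; 30; 22; 25]) (42, [:: 20; 30; 22; 24]) (sc 12)))
              (Seq (Assign (6, [:: 20; 30; 22; 25]) (Cell (7, [:: 20; 30; 22; 24])))
                   (NOp NAdd (42, [:: 20; 30; 22; 25]) (sc 25) (sc 12))))))
      (Assign (8, [:: 22]) (Cell (6, [:: 20; 30; 22; 2])))).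

Definition copy_rates : cmd :=
  Seq (Assign (10, [:: 20; 31; 22; 24]) (Cell (10, [:: 20; 30; 22; 24])))
      (Assign (11, [:: 20; 31; 22; 24]) (Cell (11, [:: 20; 30; 22; 24]))).

Definition add_rates : cmd :=
  Seq (Assign (10, [:: 20; 31; 22; 24])
         (Bin RAdd (Cell (10, [:: 20; 30; 22; 24])) (Cell (14, [:: 20; 30; 22]))))
      (Assign (11, [:: 20; 31; 22; 24])
         (Bin RAdd (Cell (11, [:: 20; 30; 22; 24]))
                   (Bin RMul (Cell (14, [:: 20; 30; 22])) (Cell (1, [:: 22; 30; 24]))))).

(** Only strict comparisons can be tested, so equality of the chosen warehouse with [l + 1] takes
    two nested tests. The oracle's answer is copied from 40 to 41 because 40 is reused for the next
    type. *)
Definition rate_prog : cmd :=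
  For 22 23 0
    (Seq (Phi (9, [:: 20; 30; 22]) (sc 22) (sc 30) 40)
    (Seq (NOp NAdd (41, [:: 20; 30; 22]) (40, [:: 22]) (sc 12))
    (Seq (Assign (14, [:: 20; 30; 22]) (Bin RMul (Cell (0, [:: 30; 20])) (Cell (9, [:: 20; 30; 22]))))
         (For 24 25 2
            (IfNat (42, [:: 20; 30; 22; 2]) (sc 25) copy_rates
              (IfNat (sc 25) (42, [:: 20; 30; 22; 2]) copy_rates add_rates)))))).

Definition value_prog : cmd :=
  For 22 23 0 (For 24 25 2 (For 28 29 3
    (Assign (2, [:: 21; 22; 24; 29])
       (Bin RAdd (Cell (2, [:: 20; 22; 24; 29]))
          (Bin RSub (Cell (11, [:: 20; 1; 22; 24]))
             (Bin RMul (Cell (10, [:: 20; 1; 22; 24]))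
                (Bin RSub (Cell (2, [:: 20; 22; 24; 29])) (Cell (2, [:: 20; 22; 24; 28]))))))))).

Definition plan_prog : cmd :=
  For 20 21 3
    (Seq (NOp NSub (sc 32) (sc 3) (sc 21))
    (Seq price_prog
    (Seq (For 30 31 1 (Seq best_prog (Seq (Oracle (sc 30) 8 40) rate_prog)))
         value_prog))).

(** Scalar 36 is the stage of the current period, 5 the current type, and 2 holds L, so the last
    index of array 42 selects the final choice. Scalar 37 turns the warehouse number into an index;
    the code L+1 is formed from scalars 2 and 11. *)
Definition output_prog : cmd :=
  Seq (NOp NSub (sc 35) (sc 3) (sc 4))
  (Seq (NOp NSub (sc 36) (sc 35) (sc 11))
  (For 22 23 0
    (IfNat (sc 12) (41, [:: 36; 5; 22])
      (IfNat (sc 12) (42, [:: 36; 5; 22; 2])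
        (Seq (NOp NSub (sc 37) (42, [:: 36; 5; 22; 2]) (sc 11))
           (IfNat (sc 12) (7, [:: 22; 37])
             (NOp NAdd (1, [:: 12; 22]) (42, [:: 36; 5; 22; 2]) (sc 12))
             (NOp NAdd (1, [:: 12; 22]) (sc 2) (sc 11))))
        (NOp NAdd (1, [:: 12; 22]) (sc 2) (sc 11)))
      (NOp NAdd (1, [:: 12; 22]) (sc 12) (sc 12))))).

(** Arrays 0 and 1 hold inputs and outputs without a clash, since cells differ in the length of
    their index. Only scalar 0, containing n, is overwritten by the number 1 of listed decisions,
    and this comes last. *)
Definition planner : cmd :=
  Seq (NConst (sc 11) 1)
  (Seq plan_prog
  (Seq output_prog
  (Seq (RConst (0, [:: 12]) 1) (NConst (sc 0) 1)))).

Lemma growR (R : realType) (M : model R) s s' c v :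
  grows M s s' -> rmem s c = v -> mr M c = Some v -> rmem s' c = v.
Proof. by move=> [_ h] e k; have := h c; rewrite /kr k; apply. Qed.

Lemma growN (R : realType) (M : model R) s s' c v :
  grows M s s' -> nmem s c = v -> mn M c = Some v -> nmem s' c = v.
Proof. by move=> [h _] e k; have := h c; rewrite /kn k; apply. Qed.

(** * Correctness of the program *)

Section Planner.
Variables (R : realType) (n m L T : nat) (P : problem R n m L T) (O : oracle R n m).
Variables (h : history n m L) (j0 : 'I_m).
Variables (ok : R -> Prop) (bits : nat -> R -> Prop).
(** [bits k] bounds what arises from basic quantities by at most [k] nested operations. Sizes do not
    pile up along the run: rates, values and smoothed values are bounded at level 0 by their
    definitions, whatever computed them. Level 8 exceeds every nesting that occurs. *)
Hypothesis bits_ok : forall u, bits 8 u -> ok u.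
Hypothesis bits_op : forall k o a b, bits k a -> bits k b ->
  if o is RDiv then True else bits k.+1 (real_op o a b).
Hypothesis bitsS : forall k u, bits k u -> bits k.+1 u.
Hypothesis bits_int : forall k : nat, (k <= T.+1)%N -> bits 0 k%:R.
Hypothesis bits_arr : forall j u, bits 0 (arr P j u).
Hypothesis bits_rew : forall i j l, bits 0 (rew P i j l).
Hypothesis bits_drift : forall i l, bits 0 (drift P i l).
Hypothesis bits_left : forall i l s x, (s <= T)%N -> (x <= T)%N -> bits 0 (left_stock P i l s x).
Hypothesis bits_value : forall u i l s x, (u <= T)%N -> (s <= T)%N -> (x <= T)%N ->
  bits 0 (smooth_value P (value P O u) i l s x).
Hypothesis bits_demand : forall u v i j, bits 0 (demand P O u v i j).
Hypothesis bits_sale : forall u i l k, (u <= T)%N -> (k <= m)%N -> bits 0 (sale_rate P O u (value P O u) k i l).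
Hypothesis bits_gain : forall u i l k, (u <= T)%N -> (k <= m)%N -> bits 0 (gain_rate P O u (value P O u) k i l).

Let N := (n + m + L + T)%N.

Definition offered u j i : nat :=
  at_index 0%N (fun i' : 'I_n => (i' \in offer P O u (value P O u) j) : nat) i.
Definition final_code i : nat :=
  at_index 0%N (fun i' : 'I_n =>
    decision_code (plan P O (T - (size h).+1) (stock P h) j0) i') i.

(** The arrays 8 and 40 are reused for every pair [uj] of a stage and a type. *)
Definition contents (uj : option (nat * nat)) : model R := Model
  (fun c => match c with
   | (6, [:: i; l]) => Some (array2 0%N (stock0 P) [:: i; l])
   | (7, [:: i; l]) => Some (array2 0%N (stock P h) [:: i; l])
   | (40, [:: i]) => if uj is Some (u, j) then Some (offered u j i) else None
   | (41, [:: u; j; i]) => Some (offered u j i)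
   | (42, [:: u; j; i; l]) => Some (best P u (value P O u) j i l).2
   | (1, [:: 0; i]) => Some (final_code i)
   | _ => None
   end)%N
  (fun c => match c with
   | (0, [:: _]) => Some 1%R
   | (0, [:: j; u]) => Some (arr P j u)
   | (1, [:: i; j; l]) => Some (rew P i j l)
   | (2, [:: u; i; l; x]) => Some (value P O u i l x)
   | (3, [:: i; l]) => Some (drift P i l)
   | (4, [:: i; l; s; x]) => Some (left_stock P i l s x)
   | (5, [:: u; i; l; s; x]) => Some (smooth_value P (value P O u) i l s x)
   | (6, [:: u; j; i; l]) => Some (best P u (value P O u) j i l).1
   | (7, [:: u; j; i; l]) => Some (margin P u (value P O u) j i l)
   | (8, [:: i]) => if uj is Some (u, j) then Some (best P u (value P O u) j i L).1 else None
   | (9, [:: u; j; i]) => Some (demand P O u (value P O u) i j)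
   | (10, [:: u; k; i; l]) => Some (sale_rate P O u (value P O u) k i l)
   | (11, [:: u; k; i; l]) => Some (gain_rate P O u (value P O u) k i l)
   | (12, [:: u; i; l]) => Some (avail P u i l)
   | (13, [:: u; i; l]) => Some (price P u (value P O u) i l)
   | (14, [:: u; j; i]) => Some (rate P O u (value P O u) j i)
   | _ => None
   end)%N.

Lemma contents_scalar uj a : mn (contents uj) (a, [::]) = None.
Proof. by do 43?[case: a => // a]. Qed.

Lemma contents_temp uj a u : (100 <= a)%N -> mr (contents uj) (a, u) = None.
Proof. by do 15?[case: a => // a]. Qed.

(** Intending more is a stronger requirement; on leaving a pair, the intentions for arrays 8 and 40
    are simply forgotten. *)
Lemma grows_contents uj s s' : grows (contents (Some uj)) s s' -> grows (contents None) s s'.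
Proof.
case: uj => u j [gn gr]; split=> -[a idx]; [have := gn (a, idx)|have := gr (a, idx)]; rewrite /kn /kr.
  by do 40?[case: a => [|a] //]; case: a => [|a] //; case: idx => [|? [|? ?]].
by do 8?[case: a => [|a] //]; case: a => [|a] //; case: idx => [|? [|? ?]].
Qed.

Lemma bits_le k u : bits 0 u -> bits k u.
Proof. by move=> b; elim: k => // k; exact: bitsS. Qed.

Lemma bitsD k a b : bits k a -> bits k b -> bits k.+1 (a + b).
Proof. by move=> ha hb; have := bits_op RAdd ha hb. Qed.

Lemma bitsB k a b : bits k a -> bits k b -> bits k.+1 (a - b).
Proof. by move=> ha hb; have := bits_op RSub ha hb. Qed.

Lemma bitsM k a b : bits k a -> bits k b -> bits k.+1 (a * b).
Proof. by move=> ha hb; have := bits_op RMul ha hb. Qed.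

Lemma bits0 : bits 0 0. Proof. exact: (@bits_int 0%N). Qed.
Lemma bits1 : bits 0 1. Proof. exact: (@bits_int 1%N). Qed.

(** Besides the inputs, these are the boundary entries that the program never writes: stock 0, stage
    0, no warehouse examined, empty partial sums. Their value is 0, which is what fresh memory
    contains. *)
Record starts (s : memory R) : Prop := Starts {
  st_arr : forall j u, rmem s (0, [:: j; u])%N = arr P j u;
  st_rew : forall i j l, rmem s (1, [:: i; j; l])%N = rew P i j l;
  st_value : forall u i l, rmem s (2, [:: u; i; l; 0])%N = value P O u i l 0;
  st_value0 : forall i l x, rmem s (2, [:: 0; i; l; x])%N = value P O 0 i l x;
  st_left : forall i l k, rmem s (4, [:: i; l; k; 0])%N = left_stock P i l k 0;
  st_smooth : forall u i l k,
    rmem s (5, [:: u; i; l; k; 0])%N = smooth_value P (value P O u) i l k 0;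
  st_best : forall u j i, rmem s (6, [:: u; j; i; 0])%N = (best P u (value P O u) j i 0).1;
  st_sale : forall u i l, rmem s (10, [:: u; 0; i; l])%N = sale_rate P O u (value P O u) 0 i l;
  st_gain : forall u i l, rmem s (11, [:: u; 0; i; l])%N = gain_rate P O u (value P O u) 0 i l;
  st_stock0 : forall i l, nmem s (6, [:: i; l])%N = array2 0%N (stock0 P) [:: i; l];
  st_stock : forall i l, nmem s (7, [:: i; l])%N = array2 0%N (stock P h) [:: i; l];
  st_choice : forall u j i, nmem s (42, [:: u; j; i; 0])%N = (best P u (value P O u) j i 0).2 }.

Lemma starts_grow uj s s' : grows (contents uj) s s' -> starts s -> starts s'.
Proof.
move=> g []; move=> *; split=> *.
all: try by apply: (growR g) => //; auto.
all: try by apply: (growN g) => //; auto.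
Qed.

Lemma assign_wp uj E s x e c v Q : agree E s ->
  [&& bound E x, scoped E e & below 100 e] -> eloc E x = c -> mr (contents uj) c = Some v ->
  okay ok E s e -> eval E s e = v -> bits 8 v ->
  (forall s', agree E s' -> grows (contents uj) s s' -> rmem s' c = v -> Q s') ->
  wp P O ok N (Assign x e) s Q.
Proof.
move=> ag /and3P[bx se be] <- mc oe ev ov q.
apply: (wp_assign P O N (contents_temp uj) ag bx se be oe _ _ _) => [||| s' a' g' k'].
- by apply: bits_ok; apply: bits_le; exact: bits0.
- by rewrite ev; apply: bits_ok.
- by rewrite mc.
- by apply: q => //; move: k'; rewrite /kr mc.
Qed.

Local Notation E0 := [:: (0, n); (1, m); (2, L); (3, T); (4, size h); (5, nat_of_ord j0);
  (11, 1); (12, 0)]%N.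
Local Notation Eu u := ([:: (32, T - u.+1), (20, u), (21, u.+1) & E0])%N.
Local Notation Eil u i l := ([:: (34, (cap P i l).-1), (33, cap P i l),
  (24, l), (25, l.+1), (22, i), (23, i.+1) & Eu u])%N.

Let TN : (T <= N)%N. Proof. exact: leq_addl. Qed.
Let LN : (L <= N)%N. Proof. rewrite /N; lia. Qed.
Let mN : (m <= N)%N. Proof. rewrite /N; lia. Qed.
Let nN : (n <= N)%N. Proof. rewrite /N; lia. Qed.

Ltac assign uj a c := apply: (@assign_wp uj _ _ _ _ c _ _ a);
  [exact: isT | reflexivity | reflexivity | | | | ].

Lemma bits_avail u i l : bits 1 (avail P u i l).
Proof.
have c := geq_minr (array2 0%N (stock0 P) [:: i; l]) T.
by apply: bitsB; apply: bits_left; rewrite ?leq_subr // /cap; apply: leq_trans c; rewrite ?leq_pred.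
Qed.

Lemma bits_price u i l : (u <= T)%N -> bits 1 (price P u (value P O u) i l).
Proof.
have c := geq_minr (array2 0%N (stock0 P) [:: i; l]) T => uT.
by apply: bitsB; apply: bits_value; rewrite ?leq_subr // /cap; apply: leq_trans c; rewrite ?leq_pred.
Qed.

Lemma bits_margin u j i l : (u <= T)%N -> bits 3 (margin P u (value P O u) j i l).
Proof.
move=> uT; apply: bitsB; last by apply: bitsS; exact: bits_price.
by apply: bitsM; [apply: bits_le; exact: bits_rew|exact: bits_avail].
Qed.

Lemma bits_best u j i k : (u <= T)%N -> bits 3 (best P u (value P O u) j i k).1.
Proof.
move=> uT; elim: k => [|k IH] /=; first by apply: bits_le; exact: bits0.
by case: ifP => // _; exact: bits_margin.
Qed.

Lemma bits_weaken k k' u : (k <= k')%N -> bits k u -> bits k' u.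
Proof. by move=> /subnK <- b; elim: (k' - k)%N => // d; exact: bitsS. Qed.

Lemma bits_smooth0 u i l x : (u <= T)%N -> (x <= T)%N -> bits 0 (value P O u i l x).
Proof. by move=> uT xT; exact: (bits_value i l uT (leq0n T) xT). Qed.

Lemma bits_rate u v j i : bits 1 (rate P O u v j i).
Proof. by apply: bitsM; [exact: bits_arr|exact: bits_demand]. Qed.

Ltac bits_leaf := first
  [ apply: bits_le; first
   [ exact: bits1 | exact: bits0 | exact: bits_arr | exact: bits_rew | exact: bits_drift
   | exact: bits_demand
   | apply: bits_left; lia | apply: bits_value; lia | apply: bits_sale; lia | apply: bits_gain; lia
   | apply: bits_smooth0; lia | apply: bits_int; lia ]
  | apply: (bits_weaken (k := 1)) => //; first [exact: bits_avail | exact: bits_rate | apply: bits_price; lia]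
  | apply: (bits_weaken (k := 3)) => //; first [apply: bits_margin; lia | apply: bits_best; lia] ].

Ltac bits_tac := match goal with
  | |- bits _ (_ - _) => apply: bitsB; bits_tac
  | |- bits _ (_ + _) => apply: bitsD; bits_tac
  | |- bits _ (_ * _) => apply: bitsM; bits_tac
  | _ => bits_leaf
  end.

Ltac okay_tac := repeat match goal with
  | |- and3 _ _ _ => split
  | |- True => exact I
  | |- ok _ => apply: bits_ok; bits_tac
  end.

Lemma smooth_prog_wp uj u i l s Q :
  agree (Eil u i l) s -> (u <= T)%N -> starts s ->
  (forall x, (x <= T)%N -> rmem s (2, [:: u; i; l; x])%N = value P O u i l x) ->
  rmem s (3, [:: i; l])%N = drift P i l ->
  (forall s', agree (Eil u i l) s' -> grows (contents uj) s s' ->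
    (forall k x, (k <= T)%N -> (x <= T)%N ->
       rmem s' (4, [:: i; l; k; x])%N = left_stock P i l k x /\
       rmem s' (5, [:: u; i; l; k; x])%N = smooth_value P (value P O u) i l k x) -> Q s') ->
  wp P O ok N smooth_prog s Q.
Proof.
move=> ag uT st hv hd q; apply: wp_seq.
pose F k x (s' : memory R) := rmem s' (4, [:: i; l; k; x])%N = left_stock P i l k x /\
       rmem s' (5, [:: u; i; l; k; x])%N = smooth_value P (value P O u) i l k x.
have Fg k x s1 s2 : grows (contents uj) s1 s2 -> F k x s1 -> F k x s2.
  by move=> g [f1 f2]; split; apply: (growR g).
refine (wp_for (contents_scalar uj) (Y := T) (I := fun x s' => forall x', (x' <= x)%N -> F 0%N x' s')
  _ _ _ _ TN ag _ _ _ _) => //.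
- by move=> k s1 s2 g f x /f; apply: Fg.
- by move=> x; rewrite leqn0 => /eqP->; split; [exact: (st_left st)|exact: (st_smooth st)].
- move=> x s1 xT a1 g1 f; apply: wp_seq.
  assign uj a1 (4, [:: i; l; 0; x.+1])%N.
  + by apply: bits_ok; apply: bits_le; apply: (@bits_int x.+1); lia.
  + by [].
  + by apply: bits_le; exact: bits_left.
  move=> s2 a2 g2 e2.
  assign uj a2 (5, [:: u; i; l; 0; x.+1])%N.
  + by [].
  + apply: (growR (grows_trans g1 g2)) => //; exact: hv.
  + by apply: bits_le; exact: bits_value.
  move=> s3 a3 g3 e3; split=> //; first exact: grows_trans g2 g3.
  move=> x'; rewrite leq_eqVlt => /orP[/eqP->|x'x].
    by split=> //; apply: (growR g3 e2).
  by apply: Fg (grows_trans g2 g3) (f _ _).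
move=> s1 a1 g1 f1.
refine (wp_for (contents_scalar uj) (Y := T)
  (I := fun k s' => forall k' x', (k' <= k)%N -> (x' <= T)%N -> F k' x' s')
  _ _ _ _ TN a1 _ _ _ _) => //.
- by move=> k s2 s3 g f k' x' kk xx; apply: Fg (f _ _ kk xx).
- by move=> k' x'; rewrite leqn0 => /eqP->; apply: f1.
- move=> k s2 kT a2 g2 f2.
  refine (wp_for (contents_scalar uj) (Y := T)
    (I := fun x s' => forall x', (x' <= x)%N -> F k.+1 x' s') _ _ _ _ TN a2 _ _ _ _) => //.
  + by move=> x s3 s4 g f x' /f; apply: Fg.
  + move=> x; rewrite leqn0 => /eqP->; have stg := starts_grow (grows_trans g1 g2) st.
    by split; [exact: (st_left stg)|exact: (st_smooth stg)].
  + move=> x s3 xT a3 g3 f3; apply: wp_seq.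
    have [l1 v1] := Fg _ _ _ _ g3 (f2 k x.+1 (leqnn _) xT).
    have [l2 v2] := Fg _ _ _ _ g3 (f2 k x (leqnn _) (ltnW xT)).
    have d3 := growR (grows_trans g1 (grows_trans g2 g3)) hd erefl.
    assign uj a3 (4, [:: i; l; k.+1; x.+1])%N.
    * rewrite /smooth_exp /= /erval /eloc /= l1 l2 d3; okay_tac.
    * by rewrite /smooth_exp /= /erval /eloc /= l1 l2 d3 /left_stock /= /smooth.
    * by bits_tac.
    move=> s4 a4 g4 e4.
    have d4 := growR g4 d3 erefl; have v14 := growR g4 v1 erefl; have v24 := growR g4 v2 erefl.
    assign uj a4 (5, [:: u; i; l; k.+1; x.+1])%N.
    * rewrite /smooth_exp /= /erval /eloc /= v14 v24 d4; okay_tac.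
    * by rewrite /smooth_exp /= /erval /eloc /= v14 v24 d4 /smooth_value /= /smooth.
    * by bits_tac.
    move=> s5 a5 g5 e5; split=> //; first exact: grows_trans g4 g5.
    move=> x'; rewrite leq_eqVlt => /orP[/eqP->|x'x].
      by split=> //; apply: (growR g5 e4).
    by apply: Fg (grows_trans g4 g5) (f3 _ _).
  move=> s3 a3 g3 f3; split=> // k' x'; rewrite leq_eqVlt => /orP[/eqP->|kk] xx; first exact: f3.
  by apply: Fg g3 (f2 _ _ _ _).
move=> s2 a2 g2 f2; apply: q => //; first exact: grows_trans g1 g2.
Qed.

Definition priced u i l (s : memory R) :=
  rmem s (12, [:: u; i; l])%N = avail P u i l /\
  rmem s (13, [:: u; i; l])%N = price P u (value P O u) i l.

Lemma priced_grow uj u i l s s' : grows (contents uj) s s' -> priced u i l s -> priced u i l s'.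
Proof. by move=> g [f1 f2]; split; apply: (growR g). Qed.

Lemma price_prog_wp uj u s Q :
  agree (Eu u) s -> (u <= T)%N -> starts s ->
  (forall i l x, (x <= T)%N -> (i < n)%N -> (l < L)%N ->
     rmem s (2, [:: u; i; l; x])%N = value P O u i l x) ->
  (forall s', agree (Eu u) s' -> grows (contents uj) s s' ->
    (forall i l, (i < n)%N -> (l < L)%N -> priced u i l s') -> Q s') ->
  wp P O ok N price_prog s Q.
Proof.
move=> ag uT st hv q.
refine (wp_for (contents_scalar uj) (Y := n)
  (I := fun i s' => forall i' l, (i' < i)%N -> (l < L)%N -> priced u i' l s') _ _ _ _ nN ag _ _ _ _) => //.
  by move=> i s1 s2 g f i' l ii lL; apply: priced_grow g (f _ _ ii lL).
move=> i s1 iN a1 g1 f1.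
refine (wp_for (contents_scalar uj) (Y := L)
  (I := fun l s' => forall l', (l' < l)%N -> priced u i l' s') _ _ _ _ LN a1 _ _ _ _) => //.
- by move=> l s2 s3 g f l' ll; apply: priced_grow g (f _ ll).
- move=> l s2 lL a2 g2 f2; have g02 := grows_trans g1 g2.
  have st2 := starts_grow g02 st.
  apply: wp_seq.
  (* Both branches of the test leave [cap P i l] in scalar 33, so the rest is verified once. *)
  suff cont (s3 : memory R) : agree [:: (33, cap P i l), (24, l), (25, l.+1), (22, i), (23, i.+1) & Eu u]%N s3 ->
      grows (contents uj) s2 s3 -> wp P O ok N
       (Seq (NOp NSub (sc 34) (sc 33) (sc 11))
       (Seq (Assign (3, [:: 22; 24]) (Bin RDiv (OfNat (sc 33)) (OfNat (sc 3))))
       (Seq smooth_prog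
       (Seq (Assign (12, [:: 20; 22; 24])
               (Bin RSub (Cell (4, [:: 22; 24; 32; 33])) (Cell (4, [:: 22; 24; 32; 34]))))
            (Assign (13, [:: 20; 22; 24])
               (Bin RSub (Cell (5, [:: 20; 22; 24; 32; 33])) (Cell (5, [:: 20; 22; 24; 32; 34]))))))))%N s3
       (fun s4 => [/\ agree [:: (24, l), (25, l.+1), (22, i), (23, i.+1) & Eu u]%N s4, grows (contents uj) s2 s4
           & forall l', (l' < l.+1)%N -> priced u i l' s4]).
    have e0 := st_stock0 st2 i l.
    apply: (wp_ifn a2) => //; rewrite /enval /eloc /= e0 => lt.
      apply: (wp_nop_scalar P O ok N (contents_scalar uj) (k := cap P i l) a2) => //.
        by rewrite /enval /eloc /= e0 addn0 /cap /minn lt.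
    apply: (wp_nop_scalar P O ok N (contents_scalar uj) (k := cap P i l) a2) => //.
      by rewrite /enval /eloc /= addn0 /cap /minn ltnNge lt.
  move=> a3 g3; apply: wp_seq.
  apply: (wp_nop_scalar P O ok N (contents_scalar uj) (k := (cap P i l).-1) a3) => //.
    by rewrite /enval /eloc /= subn1.
  move=> s4 a4 g4; apply: wp_seq.
  have cT : (cap P i l <= T)%N by exact: geq_minr.
  assign uj a4 (3, [:: i; l])%N.
  + rewrite /= /enval /=; split; last first.
    * by apply: bits_ok; apply: bits_le; exact: (bits_drift i l).
    * by apply: bits_ok; apply: bits_le; apply: (@bits_int T); lia.
    * by apply: bits_ok; apply: bits_le; apply: (@bits_int (cap P i l)); lia.
  + by [].
  + by bits_tac.
  move=> s5 a5 g5 e5; apply: wp_seq.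
  have g25 := grows_trans g3 (grows_trans g4 g5).
  have g05 := grows_trans g02 g25.
  apply: (@smooth_prog_wp uj u i l _ _ a5 uT (starts_grow g05 st) _ e5).
    by move=> x xT; apply: (growR g05) => //; apply: hv.
  move=> s6 a6 g6 f6; apply: wp_seq.
  have tT : (T - u.+1 <= T)%N by exact: leq_subr.
  have c1T : ((cap P i l).-1 <= T)%N by lia.
  have [l1 v1] := f6 _ _ tT cT; have [l2 v2] := f6 _ _ tT c1T.
  assign uj a6 (12, [:: u; i; l])%N.
  + rewrite /= /erval /eloc /= l1 l2; okay_tac.
  + by rewrite /= /erval /eloc /= l1 l2.
  + by bits_tac.
  move=> s7 a7 g7 e7.
  have v17 := growR g7 v1 erefl; have v27 := growR g7 v2 erefl.
  assign uj a7 (13, [:: u; i; l])%N.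
  + rewrite /= /erval /eloc /= v17 v27; okay_tac.
  + by rewrite /= /erval /eloc /= v17 v27.
  + by bits_tac.
  move=> s8 a8 g8 e8.
  have g28 := grows_trans g25 (grows_trans g6 (grows_trans g7 g8)).
  split=> //; first exact: agree_cons2 a8.
  move=> l'; rewrite ltnS leq_eqVlt => /orP[/eqP->|ll]; last by apply: priced_grow g28 (f2 _ ll).
  by split=> //; apply: (growR g8 e7).
- move=> s2 a2 g2 f2; split=> // i' l; rewrite ltnS leq_eqVlt => /orP[/eqP->|ii] lL; first exact: f2.
  by apply: priced_grow g2 (f1 _ _ ii lL).
Qed.

Local Notation Ej u j := ([:: (30, j), (31, j.+1) & Eu u])%N.

Lemma best_prog_wp u j s Q :
  agree (Ej u j) s -> (u <= T)%N -> starts s ->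
  (forall i l, (i < n)%N -> (l < L)%N -> priced u i l s) ->
  (forall s', agree (Ej u j) s' -> grows (contents (Some (u, j))) s s' ->
    (forall i, (i < n)%N -> rmem s' (8, [:: i])%N = (best P u (value P O u) j i L).1 /\
       nmem s' (42, [:: u; j; i; L])%N = (best P u (value P O u) j i L).2) -> Q s') ->
  wp P O ok N best_prog s Q.
Proof.
move=> ag uT st hp q; set uj := Some (u, j) in q *.
pose F i (s' : memory R) := rmem s' (8, [:: i])%N = (best P u (value P O u) j i L).1 /\
       nmem s' (42, [:: u; j; i; L])%N = (best P u (value P O u) j i L).2.
have Fg i s1 s2 : grows (contents uj) s1 s2 -> F i s1 -> F i s2.
  by move=> g [f1 f2]; split; [apply: (growR g)|apply: (growN g)].
refine (wp_for (contents_scalar uj) (Y := n)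
  (I := fun i s' => forall i', (i' < i)%N -> F i' s') _ _ _ _ nN ag _ _ _ _) => //.
  by move=> i s1 s2 g f i' ii; apply: Fg g (f _ ii).
move=> i s1 iN a1 g1 f1; apply: wp_seq.
pose G l (s' : memory R) := rmem s' (6, [:: u; j; i; l])%N = (best P u (value P O u) j i l).1 /\
       nmem s' (42, [:: u; j; i; l])%N = (best P u (value P O u) j i l).2.
have st1 := starts_grow g1 st.
refine (wp_for (contents_scalar uj) (Y := L) (I := G) _ _ _ _ LN a1 _ _ _ _) => //.
- by move=> l s2 s3 g [f2 f3]; split; [apply: (growR g)|apply: (growN g)].
- by split; [exact: (st_best st1)|exact: (st_choice st1)].
- move=> l s2 lL a2 g2 [b2 c2]; have st2 := starts_grow g2 st1; apply: wp_seq.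
  have [p1 p2] := priced_grow (grows_trans g1 g2) (hp i l iN lL).
  have r2 := st_rew st2 i j l.
  assign uj a2 (7, [:: u; j; i; l])%N.
  + rewrite /= /erval /eloc /= p1 p2 r2; okay_tac.
  + by rewrite /= /erval /eloc /= p1 p2 r2.
  + by bits_tac.
  move=> s3 a3 g3 e3.
  have b3 := growR g3 b2 erefl; have c3 := growN g3 c2 erefl.
  apply: (wp_ifr a3) => //; rewrite /eloc /= e3 b3 => cmp; apply: wp_seq.
    assign uj a3 (6, [:: u; j; i; l.+1])%N => //.
    * by rewrite /= /erval /eloc /= b3 cmp.
    * by bits_tac.
    move=> s4 a4 g4 e4; have c4 := growN g4 c3 erefl.
    apply: (wp_nop P O ok N (M := contents uj) a4) => //.
      by rewrite /enval /eloc /= c4 addn0 cmp.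
    move=> s5 a5 g5; rewrite /kn /= /eloc /= => e5.
    split=> //; first exact: grows_trans g3 (grows_trans g4 g5).
    by split=> //; apply: (growR g5 e4).
  assign uj a3 (6, [:: u; j; i; l.+1])%N => //.
  * by rewrite /= /erval /eloc /= e3 leNgt cmp.
  * by bits_tac.
  move=> s4 a4 g4 e4.
  apply: (wp_nop P O ok N (M := contents uj) a4) => //.
    by rewrite /enval /eloc /= addn0 leNgt cmp.
  move=> s5 a5 g5; rewrite /kn /= /eloc /= => e5.
  split=> //; first exact: grows_trans g3 (grows_trans g4 g5).
  by split=> //; apply: (growR g5 e4).
move=> s2 a2 g2 [b2 c2].
assign uj a2 (8, [:: i])%N => //.
  by bits_tac.
move=> s3 a3 g3 e3; split=> //; first exact: grows_trans g2 g3.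
move=> i'; rewrite ltnS leq_eqVlt => /orP[/eqP->|ii]; last by apply: Fg (grows_trans g2 g3) (f1 _ ii).
by split=> //; apply: (growN g3 c2).
Qed.

(** The oracle is a function and [offer] is one of its values, so it is enough that array 8 agrees
    with [rewards] on all products. *)
Lemma oracle_wp u j s Q :
  agree (Ej u j) s -> (j < m)%N ->
  (forall i, (i < n)%N -> rmem s (8, [:: i])%N = (best P u (value P O u) j i L).1) ->
  (forall s', agree (Ej u j) s' -> grows (contents (Some (u, j))) s s' ->
    (forall i, (i < n)%N -> nmem s' (40, [:: i])%N = offered u j i) -> Q s') ->
  wp P O ok N (Oracle (sc 30) 8 40) s Q.
Proof.
move=> ag jm hr q; apply: wp_basic (ExecOracle _ _ _ _ _ _ _) _ _ => //.
have nj : nval s (sc 30) = j by apply: (ag (30, j)%N); rewrite inE eqxx.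
have e : O (Ordinal jm) [ffun i : 'I_n => rmem s (8%N, [:: i : nat])] = offer P O u (value P O u) j.
  rewrite /offer (at_index_ltn _ _ jm); congr (O _ _); apply/ffunP => i.
  by rewrite !ffunE hr.
rewrite /oracle_query nj (at_index_ltn _ _ jm) e; apply: q.
- by move=> p pE /=; rewrite (ag p).
- split=> // -[a [|i [|? ?]]] //; rewrite /kn /=; case: (eqVneq a 40%N) => [->|] //=.
  by rewrite /offered /at_index; case: insub.
- by move=> i iN /=; rewrite /offered !(at_index_ltn _ _ iN).
Qed.

Definition summed u k i l (s : memory R) :=
  rmem s (10, [:: u; k; i; l])%N = sale_rate P O u (value P O u) k i l /\
  rmem s (11, [:: u; k; i; l])%N = gain_rate P O u (value P O u) k i l.

Lemma summed_grow uj u k i l s s' : grows (contents uj) s s' -> summed u k i l s -> summed u k i l s'.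
Proof. by move=> g [f1 f2]; split; apply: (growR g). Qed.

Lemma copy_rates_wp uj E u j i l s Q :
  E = [:: (24, l), (25, l.+1), (22, i), (23, i.+1) & Ej u j]%N ->
  agree E s -> (u <= T)%N -> (j < m)%N -> summed u j i l s ->
  served P u (value P O u) j i l = false ->
  (forall s', agree E s' -> grows (contents uj) s s' -> summed u j.+1 i l s' -> Q s') ->
  wp P O ok N copy_rates s Q.
Proof.
move=> -> ag uT jm [b1 b2] sv q; apply: wp_seq.
assign uj ag (10, [:: u; j.+1; i; l])%N => //.
- by rewrite /= /erval /eloc /= b1 /sale_rate big_nat_recr //= sv addr0.
- by bits_tac.
move=> s1 a1 g1 e1; have b3 := growR g1 b2 erefl.
assign uj a1 (11, [:: u; j.+1; i; l])%N => //.
- by rewrite /= /erval /eloc /= b3 /gain_rate big_nat_recr //= sv addr0.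
- by bits_tac.
move=> s2 a2 g2 e2; apply: q => //; first exact: grows_trans g1 g2.
by split=> //; apply: (growR g2 e1).
Qed.

Lemma add_rates_wp uj E u j i l s Q :
  E = [:: (24, l), (25, l.+1), (22, i), (23, i.+1) & Ej u j]%N ->
  agree E s -> (u <= T)%N -> (j < m)%N -> starts s -> summed u j i l s ->
  rmem s (14, [:: u; j; i])%N = rate P O u (value P O u) j i ->
  served P u (value P O u) j i l ->
  (forall s', agree E s' -> grows (contents uj) s s' -> summed u j.+1 i l s' -> Q s') ->
  wp P O ok N add_rates s Q.
Proof.
move=> -> ag uT jm st [b1 b2] hr sv q; apply: wp_seq.
assign uj ag (10, [:: u; j.+1; i; l])%N.
- rewrite /= /erval /eloc /= b1 hr; okay_tac.
- by rewrite /= /erval /eloc /= b1 hr /sale_rate big_nat_recr //= sv.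
- by bits_tac.
move=> s1 a1 g1 e1; have b3 := growR g1 b2 erefl; have r3 := growR g1 hr erefl.
have w3 := st_rew (starts_grow g1 st) i j l.
assign uj a1 (11, [:: u; j.+1; i; l])%N.
- rewrite /= /erval /eloc /= b3 r3 w3; okay_tac.
- by rewrite /= /erval /eloc /= b3 r3 w3 /gain_rate big_nat_recr //= sv.
- by bits_tac.
move=> s2 a2 g2 e2; apply: q => //; first exact: grows_trans g1 g2.
by split=> //; apply: (growR g2 e1).
Qed.

Lemma rate_prog_wp u j s Q :
  agree (Ej u j) s -> (u < T)%N -> (j < m)%N -> starts s ->
  (forall i l, (i < n)%N -> (l < L)%N -> summed u j i l s) ->
  (forall i, (i < n)%N -> nmem s (40, [:: i])%N = offered u j i) ->
  (forall i, (i < n)%N -> nmem s (42, [:: u; j; i; L])%N = (best P u (value P O u) j i L).2) ->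
  (forall s', agree (Ej u j) s' -> grows (contents (Some (u, j))) s s' ->
    (forall i, (i < n)%N -> nmem s' (41, [:: u; j; i])%N = offered u j i /\
      forall l, (l < L)%N -> summed u j.+1 i l s') -> Q s') ->
  wp P O ok N rate_prog s Q.
Proof.
move=> ag uT jm st hs h40 h42 q; set uj := Some (u, j) in q *.
pose F i (s' : memory R) := nmem s' (41, [:: u; j; i])%N = offered u j i /\
      forall l, (l < L)%N -> summed u j.+1 i l s'.
have Fg i s1 s2 : grows (contents uj) s1 s2 -> F i s1 -> F i s2.
  by move=> g [f1 f2]; split=> [|l /f2]; [exact: growN g f1 _|exact: summed_grow g].
refine (wp_for (contents_scalar uj) (Y := n)
  (I := fun i s' => forall i', (i' < i)%N -> F i' s') _ _ _ _ nN ag _ _ _ _) => //.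
  by move=> i s1 s2 g f i' ii; apply: Fg g (f _ ii).
move=> i s1 iN a1 g1 f1; apply: wp_seq.
have ph : phi_query P s1 (sc 22) (sc 30) 40 = demand P O u (value P O u) i j.
  rewrite /phi_query.
  have -> : nval s1 (sc 22) = i by apply: (a1 (22, i)%N); rewrite !inE eqxx.
  have -> : nval s1 (sc 30) = j by apply: (a1 (30, j)%N); rewrite !inE eqxx ?orbT.
  have -> // : [set i' : 'I_n | nmem s1 (40, [:: i' : nat])%N != 0%N] = offer P O u (value P O u) j.
  apply/setP => i'; rewrite inE (growN g1 (h40 _ (ltn_ord i')) erefl) /offered at_indexE.
  by case: (_ \in _).
have uT' := ltnW uT.
apply: (wp_rwrite (M := contents uj) (ExecPhi _ _ _) _ a1) => //.
  by rewrite ph; apply: bits_ok; bits_tac.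
move=> s2 a2 g2; rewrite /kr /= => e2; apply: wp_seq.
have o2 := growN (grows_trans g1 g2) (h40 i iN) erefl.
apply: (wp_nop P O ok N (M := contents uj) a2) => //.
  by rewrite /enval /eloc /= o2 addn0.
move=> s3 a3 g3; rewrite /kn /= => e3; apply: wp_seq.
have g03 := grows_trans g1 (grows_trans g2 g3).
have l3 := st_arr (starts_grow g03 st) j u.
have d3 := growR g3 e2 erefl.
assign uj a3 (14, [:: u; j; i])%N.
- rewrite /= /erval /eloc /= d3 l3; okay_tac.
- by rewrite /= /erval /eloc /= d3 l3.
- by rewrite /rate; bits_tac.
move=> s4 a4 g4 e4; have g04 := grows_trans g03 g4.
refine (wp_for (contents_scalar uj) (Y := L)
  (I := fun l s' => forall l', (l' < l)%N -> summed u j.+1 i l' s') _ _ _ _ LN a4 _ _ _ _) => //.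
- by move=> l s5 s6 g f l' ll; apply: summed_grow g (f _ ll).
- move=> l s5 lL a5 g5 f5; have g05 := grows_trans g04 g5.
  have c5 := growN g05 (h42 i iN) erefl; have b5 := summed_grow g05 (hs i l iN lL).
  have done (s6 : memory R) : agree [:: (24, l), (25, l.+1), (22, i), (23, i.+1) & Ej u j]%N s6 ->
     grows (contents uj) s5 s6 -> summed u j.+1 i l s6 ->
     [/\ agree [:: (24, l), (25, l.+1), (22, i), (23, i.+1) & Ej u j]%N s6, grows (contents uj) s5 s6
       & forall l', (l' < l.+1)%N -> summed u j.+1 i l' s6].
    move=> a6 g6 x6; split=> // l'; rewrite ltnS leq_eqVlt => /orP[/eqP->//|ll].
    by apply: summed_grow g6 (f5 _ ll).
  apply: (wp_ifn a5) => //; rewrite /enval /eloc /= c5 => lt.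
    apply: (@copy_rates_wp uj _ u j i l) => //.
    by rewrite /served; apply/eqP; lia.
  apply: (wp_ifn a5) => //; rewrite /enval /eloc /= c5 => lt'.
    apply: (@copy_rates_wp uj _ u j i l) => //.
    by rewrite /served; apply/eqP; lia.
  apply: (@add_rates_wp uj _ u j i l) => //.
  + exact: starts_grow g05 st.
  + exact: (growR g5 e4).
  + by rewrite /served; apply/eqP; lia.
- move=> s5 a5 g5 f5; split=> //.
    exact: grows_trans g2 (grows_trans g3 (grows_trans g4 g5)).
  move=> i'; rewrite ltnS leq_eqVlt => /orP[/eqP->|ii]; last first.
    by apply: Fg (f1 _ ii); apply: grows_trans g2 (grows_trans g3 (grows_trans g4 g5)).
  by split=> //; apply: (growN (grows_trans g4 g5) e3).
Qed.

Definition planned u j (s : memory R) := forall i, (i < n)%N ->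
  nmem s (41, [:: u; j; i])%N = offered u j i /\
  nmem s (42, [:: u; j; i; L])%N = (best P u (value P O u) j i L).2.

Lemma planned_grow uj u j s s' : grows (contents uj) s s' -> planned u j s -> planned u j s'.
Proof. by move=> g f i /f[f1 f2]; split; apply: (growN g). Qed.

Definition valued u (s : memory R) := forall i l x, (x <= T)%N -> (i < n)%N -> (l < L)%N ->
  rmem s (2, [:: u; i; l; x])%N = value P O u i l x.

Lemma valued_grow uj u s s' : grows (contents uj) s s' -> valued u s -> valued u s'.
Proof. by move=> g f i l x xT iN lL; apply: (growR g (f _ _ _ xT iN lL)). Qed.

Lemma value_prog_wp u s Q :
  agree (Eu u) s -> (u < T)%N -> starts s -> valued u s ->
  (forall i l, (i < n)%N -> (l < L)%N -> summed u m i l s) ->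
  (forall s', agree (Eu u) s' -> grows (contents None) s s' -> valued u.+1 s' -> Q s') ->
  wp P O ok N value_prog s Q.
Proof.
move=> ag uT st hv hs q.
pose F i l x (s' : memory R) := rmem s' (2, [:: u.+1; i; l; x])%N = value P O u.+1 i l x.
have Fg i l x s1 s2 : grows (contents None) s1 s2 -> F i l x s1 -> F i l x s2.
  by move=> g f; apply: (growR g).
refine (wp_for (contents_scalar None) (Y := n) (I := fun i s' => forall i' l x, (x <= T)%N ->
  (i' < i)%N -> (l < L)%N -> F i' l x s') _ _ _ _ nN ag _ _ _ _) => //.
  by move=> i s1 s2 g f i' l x xT ii lL; apply: Fg g (f _ _ _ xT ii lL).
move=> i s1 iN a1 g1 f1.
refine (wp_for (contents_scalar None) (Y := L) (I := fun l s' => forall l' x, (x <= T)%N ->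
  (l' < l)%N -> F i l' x s') _ _ _ _ LN a1 _ _ _ _) => //.
- by move=> l s2 s3 g f l' x xT ll; apply: Fg g (f _ _ xT ll).
- move=> l s2 lL a2 g2 f2.
  refine (wp_for (contents_scalar None) (Y := T) (I := fun x s' => forall x', (x' <= x)%N ->
    F i l x' s') _ _ _ _ TN a2 _ _ _ _) => //.
  + by move=> x s3 s4 g f x' xx; apply: Fg g (f _ xx).
  + move=> x; rewrite leqn0 => /eqP->.
    exact: (st_value (starts_grow (grows_trans g1 g2) st)).
  + move=> x s3 xT a3 g3 f3; have g03 := grows_trans g1 (grows_trans g2 g3).
    have [b1 b2] := summed_grow g03 (hs i l iN lL).
    have v1 := valued_grow g03 hv xT iN lL; have v2 := valued_grow g03 hv (ltnW xT) iN lL.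
    assign (@None (nat * nat)) a3 (2, [:: u.+1; i; l; x.+1])%N.
    * rewrite /= /erval /eloc /= b1 b2 v1 v2; okay_tac.
    * by rewrite /= /erval /eloc /= b1 b2 v1 v2.
    * by bits_tac.
    move=> s4 a4 g4 e4; split=> // x'; rewrite leq_eqVlt => /orP[/eqP->//|xx].
    by apply: Fg g4 (f3 _ xx).
  + move=> s3 a3 g3 f3; split=> // l' x xT; rewrite ltnS leq_eqVlt => /orP[/eqP->|ll]; first exact: f3.
    by apply: Fg g3 (f2 _ _ xT ll).
- move=> s2 a2 g2 f2; split=> // i' l x xT; rewrite ltnS leq_eqVlt => /orP[/eqP->|ii] lL; first exact: f2.
  by apply: Fg g2 (f1 _ _ _ xT ii lL).
Qed.

Lemma plan_prog_wp s Q :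
  agree E0 s -> starts s ->
  (forall s', agree E0 s' -> grows (contents None) s s' ->
     (forall u j, (u < T)%N -> (j < m)%N -> planned u j s') -> Q s') ->
  wp P O ok N plan_prog s Q.
Proof.
move=> ag st q.
refine (wp_for (contents_scalar None) (Y := T) (I := fun u s' => valued u s' /\
  forall u' j, (u' < u)%N -> (j < m)%N -> planned u' j s') _ _ _ _ TN ag _ _ _ _) => //.
- move=> u s1 s2 g [f1 f2]; split; first exact: valued_grow g f1.
  by move=> u' j uu jm; apply: planned_grow g (f2 _ _ uu jm).
- by split=> // i l x _ _ _; exact: (st_value0 st).
- move=> u s1 uT a1 g1 [v1 f1]; apply: wp_seq.
  apply: (wp_nop_scalar P O ok N (contents_scalar None) (k := (T - u.+1)%N) a1) => //.
  move=> s2 a2 g2; apply: wp_seq; have v2 := valued_grow g2 v1.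
  have st2 := starts_grow (grows_trans g1 g2) st.
  apply: (price_prog_wp (uj := None) a2 (ltnW uT) st2) => // s3 a3 g3 p3; apply: wp_seq.
  have st3 := starts_grow g3 st2.
  refine (wp_for (contents_scalar None) (Y := m) (I := fun j s' =>
    (forall i l, (i < n)%N -> (l < L)%N -> summed u j i l s') /\
    forall j', (j' < j)%N -> planned u j' s') _ _ _ _ mN a3 _ _ _ _) => //.
  + move=> j s4 s5 g [f4 f5]; split=> [i l iN lL|j' jj].
      exact: summed_grow g (f4 _ _ iN lL).
    exact: planned_grow g (f5 _ jj).
  + split=> // i l _ _; split; [exact: (st_sale st3)|exact: (st_gain st3)].
  + move=> j s4 jm a4 g4 [f4 f4']; apply: wp_seq.
    apply: (best_prog_wp a4 (ltnW uT) (starts_grow g4 st3)).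
      by move=> i l iN lL; apply: priced_grow g4 (p3 _ _ iN lL).
    move=> s5 a5 g5 f5; apply: wp_seq.
    apply: (oracle_wp a5 jm) => [i /f5[]//|s6 a6 g6 f6].
    have g46 := grows_trans g5 g6.
    apply: (rate_prog_wp a6 uT jm) => //.
    * exact: starts_grow (grows_contents g46) (starts_grow g4 st3).
    * by move=> i l iN lL; apply: summed_grow g46 (f4 _ _ iN lL).
    * by move=> i /f5[_ f]; apply: (growN g6 f).
    move=> s7 a7 g7 f7; have g47 := grows_trans g46 g7.
    split=> //; first exact: grows_contents g47.
    split=> [i l /f7[_ e] /e //|j'].
    rewrite ltnS leq_eqVlt => /orP[/eqP->|jj]; last by apply: planned_grow g47 (f4' _ jj).
    move=> i iN; split; first by have [] := f7 _ iN.
    by have [_ f] := f5 _ iN; apply: (growN (grows_trans g6 g7) f).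
  move=> s4 a4 g4 [f4 f4'].
  have g24 := grows_trans g3 g4.
  apply: (value_prog_wp a4 uT (starts_grow g4 st3) (valued_grow g24 v2)) => //.
  move=> s5 a5 g5 v5; have g25 := grows_trans g24 g5.
  split.
  + by apply: agree_sub a5 => p pE; rewrite inE pE orbT.
  + exact: grows_trans g2 g25.
  split=> // u' j; rewrite ltnS leq_eqVlt => /orP[/eqP->|uu] jm.
    by apply: planned_grow g5 (f4' _ jm).
  by apply: planned_grow (grows_trans g2 g25) (f1 _ _ uu jm).
- by move=> s1 a1 g1 [_ f1]; apply: q.
Qed.

Lemma final_codeE u (i : 'I_n) : u = (T - (size h).+1)%N -> final_code i =
  if (0 < offered u j0 i)%N then
    if (best P u (value P O u) j0 i L).2 is k.+1 then
      if (0 < array2 0%N (stock P h) [:: nat_of_ord i; k])%N then k.+1 else L.+1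
    else L.+1
  else 0%N.
Proof.
move=> eu; rewrite /final_code /offered !at_indexE /decision_code /= -eu.
case: (_ \in _) => //=; rewrite ffunE.
case e: (best _ _ _ _ _ _).2 => [|k] //.
have kL : (k < L)%N by rewrite -e best_le.
by rewrite insubT /= at_indexE (at_index_ltn _ _ kL); case: ifP.
Qed.

Lemma output_prog_wp s Q :
  (size h < T)%N -> agree E0 s -> starts s ->
  (forall u j, (u < T)%N -> (j < m)%N -> planned u j s) ->
  (forall s', agree E0 s' -> grows (contents None) s s' ->
     (forall i, (i < n)%N -> nmem s' (1, [:: 0; i])%N = final_code i) -> Q s') ->
  wp P O ok N output_prog s Q.
Proof.
move=> hT ag st pl q; apply: wp_seq.
apply: (wp_nop_scalar P O ok N (contents_scalar None) (k := (T - size h)%N) ag) => //.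
move=> s1 a1 g1; apply: wp_seq; set u := (T - (size h).+1)%N.
apply: (wp_nop_scalar P O ok N (contents_scalar None) (k := u) a1) => //.
  by rewrite /enval /= /u; lia.
move=> s2 a2 g2.
have uT : (u < T)%N by rewrite /u; lia.
have g02 := grows_trans g1 g2.
refine (wp_for (contents_scalar None) (Y := n) (I := fun i s' => forall i', (i' < i)%N ->
  nmem s' (1, [:: 0; i'])%N = final_code i') _ _ _ _ nN a2 _ _ _ _) => //.
- by move=> i s3 s4 g f i' /f e; apply: (growN g e).
- move=> i s3 iN a3 g3 f3; have g03 := grows_trans g02 g3.
  have [o3 c3] := planned_grow g03 (pl u j0 uT (ltn_ord j0)) iN.
  have fE := final_codeE (Ordinal iN) (erefl u); rewrite /= in fE.
  (* The common end of the four cases: not offered, virtual by choice, in stock, out of stock. *)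
  have step (s4 : memory R) x y o : grows (contents None) s3 s4 ->
      forall E, agree E s4 -> {subset [:: (22, i), (23, i.+1), (36, u), (35, T - size h) & E0]%N <= E} ->
      bound E (1, [:: 12; 22])%N && nbound E x && nbound E y ->
      eloc E (1, [:: 12; 22])%N = (1, [:: 0; i])%N ->
      nat_op o (enval E s4 x) (enval E s4 y) = final_code i ->
      wp P O ok N (NOp o (1, [:: 12; 22])%N x y) s4 (fun s5 =>
        [/\ agree [:: (22, i), (23, i.+1), (36, u), (35, T - size h) & E0]%N s5,
            grows (contents None) s3 s5
          & forall i', (i' < i.+1)%N -> nmem s5 (1, [:: 0; i'])%N = final_code i']).
    move=> g4 E a4 sub /andP[/andP[b1 b2] b3] el e.
    apply: (wp_nop P O ok N (M := contents None) a4); rewrite ?b1 ?b2 ?b3 // ?el //.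
    move=> s5 a5 g5; rewrite /kn /= => e5.
    split; first exact: agree_sub sub a5.
      exact: grows_trans g4 g5.
    move=> i'; rewrite ltnS leq_eqVlt => /orP[/eqP->//|ii].
    by apply: (growN (grows_trans g4 g5) (f3 _ ii)).
  apply: (wp_ifn a3) => //; rewrite /enval /eloc /= o3 => o0; last first.
    apply: (step _ _ _ _ (grows_refl _ _) _ a3) => //.
    by rewrite /enval /= fE ltnNge o0.
  rewrite o0 in fE.
  apply: (wp_ifn a3) => //; rewrite /enval /eloc /= c3 => c0; last first.
    apply: (step _ _ _ _ (grows_refl _ _) _ a3) => //.
    by move: c0; rewrite leqn0 => /eqP c0; rewrite /enval /= fE c0 addn1.
  apply: wp_seq.
  apply: (wp_nop_scalar P O ok N (contents_scalar None)
    (k := (best P u (value P O u) j0 i L).2.-1) a3) => //.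
    by rewrite /enval /eloc /= c3 subn1.
  move=> s4 a4 g4; have t4 := st_stock (starts_grow (grows_trans g03 g4) st).
  have c4 := growN g4 c3 erefl.
  have sub : {subset [:: (22, i), (23, i.+1), (36, u), (35, T - size h) & E0]%N <=
      [:: (37, (best P u (value P O u) j0 i L).2.-1), (22, i), (23, i.+1), (36, u), (35, T - size h) & E0]%N}.
    by move=> p pE; rewrite inE pE orbT.
  case ec: (best P u (value P O u) j0 i L).2 c0 fE c4 a4 sub => [|k] // _ fE c4 a4 sub.
  apply: (wp_ifn a4) => //; rewrite /enval /eloc /= t4 => k0.
    apply: (step _ _ _ _ g4 _ a4 sub) => //.
    by rewrite /enval /eloc /= c4 addn0 fE k0.
  apply: (step _ _ _ _ g4 _ a4 sub) => //.
  by rewrite /enval /= addn1 fE ltnNge k0.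
move=> s3 a3 g3 f3; apply: q => //; last exact: grows_trans g02 g3.
by apply: agree_sub a3 => p pE; rewrite 2!in_cons pE !orbT.
Qed.

Lemma planner_wp s :
  (size h < T)%N -> agree [:: (0, n); (1, m); (2, L); (3, T); (4, size h); (5, nat_of_ord j0); (12, 0)]%N s ->
  starts s ->
  wp P O ok N planner s (fun s' => outputs s' (plan_policy P O h j0)).
Proof.
move=> hT ag st; apply: wp_seq.
apply: (wp_nconst P O ok N (contents_scalar None) ag) => // s1 a1 g1.
have a1' : agree E0 s1.
  by apply: agree_sub a1 => p; rewrite !inE; do !case: eqP => // _; rewrite ?orbT.
have st1 := starts_grow g1 st; apply: wp_seq.
apply: (plan_prog_wp a1' st1) => s2 a2 g2 f2; apply: wp_seq.
apply: (output_prog_wp hT a2 (starts_grow g2 st1) f2) => s3 a3 g3 f3; apply: wp_seq.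
apply: (@wp_rwrite _ _ _ _ _ _ _ _ _ (contents None) _ _ _ (0, [:: 12])%N 1%:~R _ _ _ a3) => //.
  by apply: ExecRConst; apply: bits_ok; apply: bits_le; exact: bits1.
move=> s4 a4 g4; rewrite /kr /= => e4.
exists (nwrite s4 (sc 0) 1), 1%N; split=> //; first exact: ExecNConst.
rewrite /outputs /=; exists (fun=> plan P O (T - (size h).+1) (stock P h) j0); split.
- by move=> [[|//] lt] /=; rewrite e4.
- move=> [[|//] lt] i /=; rewrite (growN g4 (f3 i (ltn_ord i)) erefl).
  by rewrite /final_code at_indexE.
- move=> d; rewrite /plan_policy big_mkcond big_ord_recl big_ord0 /= e4 addr0 eq_sym.
  by case: eqP.
Qed.

End Planner.

(** * Uniform bounds on time and size *)

Lemma initial_starts (R : realType) n m L T (P : problem R n m L T) O h (j : 'I_m) :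
  starts P O h (initial_memory P h j).
Proof.
split=> //; first by move=> u i l; rewrite value_stock0.
  by move=> i l k; rewrite /left_stock iter_smooth0.
by move=> u i l k; rewrite /smooth_value iter_smooth0 // value_stock0.
all: by move=> u i l; rewrite /sale_rate /gain_rate big_geq.
Qed.

Lemma initial_agree (R : realType) n m L T (P : problem R n m L T) h (j : 'I_m) :
  agree [:: (0, n); (1, m); (2, L); (3, T); (4, size h); (5, nat_of_ord j); (12, 0)]%N
    (initial_memory P h j).
Proof. by move=> p; rewrite !inE; do !case/orP; move=> /eqP->. Qed.

(** The 6 comes from [width_le], and each of up to 8 nested operations multiplies the number of bits
    by 5. *)
Definition bit_factor := (6 * 5 ^ 8)%N.

(** A single pair of constants has to bound both steps and bits, hence the sums; the 3 is the degree
    of the polynomial bounding [width]. *)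
Theorem planner_computes (R : realType) n m L T (P : problem R n m L T) (O : oracle R n m) :
  arrival_probabilities P -> choice_model P ->
  computes_within P O planner (csize planner + bit_factor) (nesting planner + 3) (plan_policy P O).
Proof.
move=> arrP choiceP h j hT; have T0 : (0 < T)%N by apply: leq_ltn_trans hT.
pose X B := (6 * (n + m + L + T + B).+1 ^ 3)%N.
pose bits k (u : R) := forall B, data_bits P B -> has_bits (5 ^ k * X B) u.
have X0 k B : (0 < 5 ^ k * X B)%N by rewrite !muln_gt0 !expn_gt0.
have bits0 u : (forall B, data_bits P B -> has_bits (width m T B) u) -> bits 0%N u.
  by move=> b B /b; apply: has_bits_le; rewrite mul1n; apply: width_le.
pose ok (u : R) := forall B, data_bits P B ->
  has_bits ((csize planner + bit_factor) * (n + m + L + T + B).+1 ^ (nesting planner + 3)) u.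
have ag := @initial_agree R n m L T P h j.
have [||||||||||||s [t [e tl o]]] :=
  @planner_wp R n m L T P O h j ok bits _ _ _ _ _ _ _ _ _ _ _ _ _ hT ag (initial_starts P O h j).
- move=> u b B dB; apply: has_bits_le (b B dB); rewrite /X /bit_factor; move: (5 ^ 8)%N => e.
  rewrite mulnA [(e * 6)%N]mulnC; apply: leq_mul; first exact: leq_addl.
  by rewrite leq_pexp2l // leq_addl.
- move=> k o a b ha hb; case: o => // B dB; rewrite expnS -mulnA.
  + exact: (has_bits_op RAdd (X0 k B) (ha B dB) (hb B dB)).
  + exact: (has_bits_op RSub (X0 k B) (ha B dB) (hb B dB)).
  + exact: (has_bits_op RMul (X0 k B) (ha B dB) (hb B dB)).
- move=> k u b B dB; apply: has_bits_le (b B dB).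
  by rewrite leq_mul2r leq_exp2l // leqnSn orbT.
- by move=> k kT; apply: bits0 => B _; exact: width_nat.
- by move=> j' u; apply: bits0 => B dB; apply: (width_small _ T0); exact: (small_arr dB).
- by move=> i j' l; apply: bits0 => B dB; apply: (width_small _ T0); exact: (small_rew dB).
- by move=> i l; apply: bits0 => B dB; exact: width_drift.
- by move=> i l k x kT xT; apply: bits0 => B dB; exact: width_left.
- by move=> u i l k x uT kT xT; apply: bits0 => B dB; exact: width_value.
- by move=> u v i j'; apply: bits0 => B dB; apply: (width_small _ T0); exact: (small_demand _ dB).
- move=> u i l k uT km; apply: bits0 => B dB.
  by have [] := width_sale_gain O arrP choiceP T0 dB u (value P O u) i l km.
- move=> u i l k uT km; apply: bits0 => B dB.
  by have [] := width_sale_gain O arrP choiceP T0 dB u (value P O u) i l km.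
exists s, t; split=> //.
apply: leq_trans tl (leq_trans (cost_le _ _) _).
by apply: leq_mul; [exact: leq_addr|rewrite leq_pexp2l // leq_addr].
Qed.

Theorem theorem3p1 (R : realType) :
  exists (prog : cmd) (a k : nat),
  forall (n m L T : nat) (P : problem R n m L T) (O : oracle R n m),
    arrival_probabilities P ->
    choice_model P ->
    stationary P ->
    (exists i l, (0 < stock0 P i l)%N) ->
    assortment_oracle P O ->
    exists pi : policy R n m L,
      [/\ feasible P pi,
          computes_within P O prog a k pi
        & Num.max (1 - (expR 1)^-1) (1 - (Num.sqrt (cmin P)%:R)^-1) * J1_star P
            <= expected_profit P pi].
Proof.
exists planner, (csize planner + bit_factor)%N, (nesting planner + 3)%N => n m L T P O.
move=> arrP choiceP statP _ oracleP; exists (plan_policy P O); split.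
- exact: plan_policy_feasible.
- exact: planner_computes.
- exact: plan_policy_guarantee.
Qed.
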